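(* $\mathrm{WMM\text{-}D} \subseteq \mathrm{OOO}^{D}{+}\mathrm{CCM}$; that is, for every number of processors $n$, every $n$-processor program and every initial state, every program behavior of the memory model $\mathrm{WMM\text{-}D}$ is also a program behavior of the physical multiprocessor model $\mathrm{OOO}^{D}{+}\mathrm{CCM}$ (out-of-order processors without load-value speculation).
   Context: **Programs and conventions.** There are $n$ processors. Processor $i$ runs a fixed program: $\mathsf{fetch}(pc)$ gives the instruction at $pc$ (never modified). Instructions are: $\mathsf{Nm}$ (non-memory, e.g. ALU/branch: from its source registers and its PC it computes a next PC and a value for a destination register), $\mathsf{Ld}$ (an address is computed from source registers, the loaded value goes to a destination register), $\mathsf{St}$ (address and data are computed from source registers), and the fences $\mathsf{Commit}$ and $\mathsf{Reconcile}$. The next PC of a non-$\mathsf{Nm}$ instruction is determined by its PC alone. Each model is a nondeterministic transition system; a rule may fire atomically whenever its guard holds; an execution is a finite sequence of rule firings from the initial state. All models start with the same registers, PCs and memory values, with all buffers empty. $\epsilon$ means ''not available''. **CCM (write-back cache memory).** State: memory $m$ with $m[a]=\langle v,t\rangle$ (value and tag of the store that wrote it; initial values carry special tags different from the tags of all stores), and for each $i$ an unordered buffer $mrb[i]$. Processor $i$ calls $\mathsf{reqLd}(idx,a)$ or $\mathsf{reqSt}(a,v,t)$, which insert $\langle \mathsf{Ld},idx,a\rangle$ or $\langle\mathsf{St},a,v,t\rangle$ into $mrb[i]$. Rules: *CCM-Ld*: remove any $\langle\mathsf{Ld},idx,a\rangle$ from some $mrb[i]$ and call $\mathsf{respLd}(idx,v,t)$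 of processor $i$, where $\langle v,t\rangle=m[a]$. *CCM-St*: remove any $\langle\mathsf{St},a,v,t\rangle$ from some $mrb[i]$, set $m[a]:=\langle v,t\rangle$, call $\mathsf{respSt}(a)$ of processor $i$. **$\mathrm{OOO}^{D}$ (out-of-order processor without value prediction).** State of each processor: PC register $pcr$, register file $rf$, reorder buffer $rob$, store buffer $sb$ (a list of entries $\langle a,v,t,iss\rangle$ ordered from oldest to youngest), and a bit vector $lf$ (initially all False). $rob$ is a list of unbounded length; each new entry gets an index larger than all indices ever used (younger = larger index; indices are never reused). An entry is $\langle pc,npc,ins,ex\rangle$ with $npc$ the (predicted) next PC and $ex\in\{\mathsf{Idle},\mathsf{Exe},\mathsf{ReEx},\mathsf{Done}\}$. The field $ins$ is $\langle\mathsf{Nm},op,srcs,dst,val\rangle$, or $\langle\mathsf{Ld},srcs,dst,a,v,t\rangle$ ($t$ = tag of the store read), or $\langle\mathsf{St},srcs,a,v,t\rangle$ ($t$ = globally unique tag assigned at fetch), or $\langle\mathsf{Commit}\rangle$, or $\langle\mathsf{Reconcile}\rangle$; the fields $val,a,v$ and the tag of a load are initially $\epsilon$. A source register of an entry is ready if the youngest older $rob$ entry writing that register has a non-$\epsilon$ value, or if no older entry writes it (then $rf$ is used); an entry is ready if all its source registers are. The commit slot is the oldest entry. Auxiliary operations. $\mathsf{flush}(idx,pc)$: delete all entries with index $\ge idx$, set $pcr:=pc$, and for each deleted $\mathsf{Ld}$ with $ex\in\{\mathsf{Exe},\mathsf{ReEx}\}$ set its $lf$ bit to True. $\mathsf{findBypass}(idx,a)$: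 search $rob$ from the entry just older than $idx$ to the oldest, then $sb$ from youngest to oldest; return $\langle v,t\rangle$ of the first executed store to $a$ found; return $\epsilon$ if a $\mathsf{Reconcile}$ is met first; return $\top$ if nothing is found. $\mathsf{findAffectedLd}(idx,a)$: search from index $idx+1$ to the youngest entry, stopping at the first $\mathsf{St}$ with computed address $a$; return the list (oldest first) of all $\mathsf{Ld}$ entries met with address $a$ and $ex\ne\mathsf{Idle}$. $\mathsf{findStaleLd}(idx,a,t)$: search from $idx+1$ to the youngest entry for the first $\mathsf{Ld}$ with address $a$, $ex=\mathsf{Done}$ and tag $t'\neq t$ and return its index; return $\top$ if there is none or if a $\mathsf{St}$ with computed address $a$ is met first. Rules: - *OOO-Fetch*: $ins=\mathsf{fetch}(pcr)$; choose a prediction $npc$ (arbitrary for $\mathsf{Nm}$, the correct next PC otherwise); append $\langle pcr,npc,ins,ex\rangle$ with $ex=\mathsf{Done}$ for fences and $\mathsf{Idle}$ otherwise; $pcr:=npc$. - *OOO-NmEx*: for a ready $\mathsf{Idle}$ $\mathsf{Nm}$ entry $idx$, compute $\langle nextpc,val\rangle$, store $val$, set the entry's next-PC field to $nextpc$ and $ex:=\mathsf{Done}$; if $nextpc$ differs from the old $npc$ then $\mathsf{flush}(idx+1,nextpc)$. - *OOO-LdAddr*: for a ready $\mathsf{Idle}$ $\mathsf{Ld}$ with address $\epsilon$, compute and record its address. - *OOO-LdBypass*: for a ready $\mathsf{Idle}$ $\mathsf{Ld}$ at $idx$ with computed address $a$, if $\mathsf{findBypass}(idx,a)=\langle res,t\rangle$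 (neither $\epsilon$ nor $\top$): set value $res$, tag $t$, $ex:=\mathsf{Done}$. - *OOO-LdReq*: for a ready $\mathsf{Idle}$ $\mathsf{Ld}$ at $idx$ with computed address $a$, if $\mathsf{findBypass}(idx,a)=\top$ and $\neg lf[idx]$: call $\mathsf{reqLd}(idx,a)$ and set $ex:=\mathsf{Exe}$. - *OOO-StEx*: for a ready $\mathsf{Idle}$ $\mathsf{St}$ at $idx$, compute address $a$ and data $v$, let $list=\mathsf{findAffectedLd}(idx,a)$, record $a,v$, set $ex:=\mathsf{Done}$; then for each $k$ in $list$ from oldest to youngest: if $rob[k].ex=\mathsf{Done}$ then $\mathsf{flush}(k,rob[k].pc)$ and stop, else $rob[k].ex:=\mathsf{ReEx}$. - *OOO-NmLdRecCom*: if the commit slot is a $\mathsf{Done}$ $\mathsf{Nm}$, $\mathsf{Ld}$ or $\mathsf{Reconcile}$, remove it and update $rf$ with its result. - *OOO-StCom*: if the commit slot is a $\mathsf{Done}$ $\mathsf{St}$, remove it and append $\langle a,v,t,\mathrm{False}\rangle$ to $sb$. - *OOO-ComCom*: if the commit slot is $\mathsf{Commit}$ and $sb$ is empty, remove it. - *OOO-StReq*: for some address $a$ in $sb$ whose oldest store has $iss=$ False, call $\mathsf{reqSt}(a,v,t)$ for that store and set its $iss$ to True. Methods called by the memory: $\mathsf{respSt}(a)$ deletes the oldest store to $a$ from $sb$. $\mathsf{respLd}(idx,res,t)$: if $lf[idx]$, set $lf[idx]:=$ False; else, for the $\mathsf{Ld}$ entry at $idx$ (address $a$): if $ex=\mathsf{ReEx}$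 set $ex:=\mathsf{Idle}$; otherwise record value $res$, tag $t$, $ex:=\mathsf{Done}$, let $k=\mathsf{findStaleLd}(idx,a,t)$, and if $k\ne\top$ do $\mathsf{flush}(k,rob[k].pc)$. $\mathrm{OOO}^{D}{+}\mathrm{CCM}$ is $n$ such processors connected to the $n$ ports of one CCM. **WMM-D.** State: a global clock $gts$ (initially 0); monolithic memory with $m[a]=\langle v,\langle i,sts\rangle,mts\rangle$ ($v$ the value, $i$ the processor that wrote it, $sts$ the creation timestamp of the store, $mts$ the timestamp of the memory value; initially the initial value with no writer and $sts=mts=0$); and for each processor $i$: register state (including PC) with a timestamp (initially 0) on every register other than PC, a timestamp $rts_i$ (initially 0), a store buffer $sb_i$ (list of $\langle a,v,sts\rangle$, oldest to youngest), and an invalidation buffer $ib_i$ of entries $\langle a,v,[ts_L,ts_U]\rangle$. Instructions execute instantaneously in program order; executing one updates registers and PC. For the next instruction let $ats$ be the maximum timestamp of its source registers, excluding PC (0 if none). Rules for processor $i$: - $\mathsf{Nm}$: execute; the destination register gets timestamp $ats$. - $\mathsf{Ld}\ a$, if $sb_i$ contains $a$: with $\langle v,sts\rangle$ the youngest for $a$ in $sb_i$, return $v$ with destination timestamp $\max(ats,rts_i,sts)$. - $\mathsf{Ld}\ a$, if $sb_i$ does not contain $a$: with $m[a]=\langle v,\langle j,sts\rangle,mts\rangle$ and $vts=mts$ if $i\ne j$, $vts=sts$ if $i=j$, return $v$ with destination timestamp $\max(ats,rts_i,vts)$; remove all entries for $a$ from $ib_i$. - $\mathsf{Ld}\ a$,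 if $sb_i$ does not contain $a$: choose any entry $\langle a,v,[ts_L,ts_U]\rangle$ of $ib_i$ with $ats\le ts_U$; return $v$ with destination timestamp $\max(ats,rts_i,ts_L)$; remove from $ib_i$ all entries for $a$ that were inserted when $gts<ts_U$. - $\mathsf{St}\ a\ v$: append $\langle a,v,ats\rangle$ to $sb_i$ and remove all entries for $a$ from $ib_i$. - $\mathsf{Reconcile}$: execute, empty $ib_i$, set $rts_i:=gts$. - $\mathsf{Commit}$: executes only if $sb_i$ is empty. - Background rule (dequeue): for some $a$ in $sb_i$, let $m[a]=\langle v',\langle i',sts'\rangle,mts\rangle$ and $ts_U=gts$; remove the oldest $\langle v,sts\rangle$ for $a$ from $sb_i$; set $m[a]:=\langle v,\langle i,sts\rangle,gts+1\rangle$ and $gts:=gts+1$; for every $j\neq i$ such that $sb_j$ does not contain $a$, insert $\langle a,v',[ts_L,ts_U]\rangle$ into $ib_j$, where $ts_L=mts$ if $j\ne i'$ and $ts_L=sts'$ if $j=i'$. **Program behavior.** Consider any finite execution at whose end all store buffers are empty. Its behavior consists of: for each processor, the sequence of instructions committed from $rob$ (in WMM-D: executed), with their results ($\mathsf{Nm}$ values and next PCs, store addresses and data, load addresses and loaded values), and the final values in the monolithic memory. $A\subseteq B$ means that every behavior of $A$ is a behavior of $B$, for the same program and initial state. *)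

(* Defs.v *)
From mathcomp Require Import all_boot.

Set Implicit Arguments.
Unset Strict Implicit.
Unset Printing Implicit Defensive.

Fixpoint rem_first {T : Type} (P : pred T) (s : seq T) : seq T :=
  if s is x :: s' then if P x then s' else x :: rem_first P s' else [::].

(* Finite executions from s0; the labels of the rule firings that have one
   are collected in order. *)
Inductive run {S L : Type} (step : S -> option L -> S -> Prop) (s0 : S) :
    seq L -> S -> Prop :=
| run_start : run step s0 [::] s0
| run_fire tr s l s' :
    run step s0 tr s -> step s l s' -> run step s0 (tr ++ seq_of_opt l) s'.

Section Machines.

Variables (Reg Addr PC : eqType) (Val : Type) (n : nat).

Notation proc := 'I_n.

(* The values in a [seq Val] are those of the source registers, in order. *)
Inductive instr : Type :=
| Nm (op : PC -> seq Val -> PC * Val) (srcs : seq Reg) (dst : Reg)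
| Ld (addr : seq Val -> Addr) (srcs : seq Reg) (dst : Reg)
| St (addr : seq Val -> Addr) (data : seq Val -> Val) (srcs : seq Reg)
| Commit
| Reconcile.

(* [seqpc] gives the next PC of the instructions other than [Nm]. *)
Record program := Program {
  fetch : PC -> instr;
  seqpc : PC -> PC
}.

Record init_state := InitState {
  init_pc : proc -> PC;
  init_rf : proc -> Reg -> Val;
  init_mem : Addr -> Val
}.

Inductive result : Type :=
| ResNm (npc : PC) (v : Val)
| ResLd (a : Addr) (v : Val)
| ResSt (a : Addr) (v : Val)
| ResFence.

Record event := Event {
  ev_pc : PC;
  ev_ins : instr;
  ev_res : result
}.

Record behavior := Behavior {
  beh_instrs : proc -> seq event;
  beh_mem : Addr -> Val
}.

(* A firing that commits (or, in an instantaneous model, executes) an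
   instruction is labelled by the processor and the event. *)
Record model := Model {
  state : Type;
  initial : state;
  step : state -> option (proc * event) -> state -> Prop;
  sbs_empty : state -> Prop;
  mem_value : state -> Addr -> Val
}.

Definition behavior_of (M : model) (b : behavior) : Prop :=
  exists (tr : seq (proc * event)) (s : state M),
    [/\ run (@step M) (initial M) tr s,
        sbs_empty s,
        forall i, beh_instrs b i = [seq l.2 | l <- tr & l.1 == i]
      & forall a, beh_mem b a = mem_value s a].

Definition behaviors_included (A B : model) : Prop :=
  forall b, behavior_of A b -> behavior_of B b.

(* [inl a] is the tag of the initial value at a; [inr (i, k)] is the tag of the
   store fetched by processor i at index k, which is globally unique because
   indices are never reused. *)
Definition tag : eqType := (Addr + proc * nat)%type.

Inductive memreq : Type :=
| ReqLd (idx : nat) (a : Addr)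
| ReqSt (a : Addr) (v : Val) (t : tag).

Inductive status : Type := Idle | Exe | ReEx | Done.

Definition is_idle (x : status) : bool := if x is Idle then true else false.
Definition is_done (x : status) : bool := if x is Done then true else false.

(* In optional fields, [None] stands for "not available". *)
Inductive robins : Type :=
| RNm (op : PC -> seq Val -> PC * Val) (srcs : seq Reg) (dst : Reg)
      (val : option Val)
| RLd (addr : seq Val -> Addr) (srcs : seq Reg) (dst : Reg)
      (a : option Addr) (v : option Val) (t : option tag)
| RSt (addr : seq Val -> Addr) (data : seq Val -> Val) (srcs : seq Reg)
      (a : option Addr) (v : option Val) (t : tag)
| RCommit
| RReconcile.

Record entry := Entry {
  e_idx : nat;
  e_pc : PC;
  e_npc : PC;
  e_ins : robins;
  e_ex : status
}.

Record sbentry := SbEntry {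
  sb_a : Addr;
  sb_v : Val;
  sb_t : tag;
  sb_iss : bool
}.

(* [rob] and [sb] are listed from oldest to youngest; [nxt] exceeds every index
   ever used. *)
Record pstate := PState {
  pcr : PC;
  rf : Reg -> Val;
  rob : seq entry;
  sb : seq sbentry;
  lf : nat -> bool;
  nxt : nat
}.

Definition set_rob (p : pstate) (es : seq entry) : pstate :=
  PState (pcr p) (rf p) es (sb p) (lf p) (nxt p).
Definition set_rf (p : pstate) (r : Reg -> Val) : pstate :=
  PState (pcr p) r (rob p) (sb p) (lf p) (nxt p).
Definition set_sb (p : pstate) (ss : seq sbentry) : pstate :=
  PState (pcr p) (rf p) (rob p) ss (lf p) (nxt p).
Definition set_lf (p : pstate) (l : nat -> bool) : pstate :=
  PState (pcr p) (rf p) (rob p) (sb p) l (nxt p).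

Definition rob_at (p : pstate) (k : nat) : option entry :=
  ohead [seq e <- rob p | e_idx e == k].
Definition older (p : pstate) (k : nat) : seq entry :=
  [seq e <- rob p | e_idx e < k].
Definition younger (p : pstate) (k : nat) : seq entry :=
  [seq e <- rob p | k < e_idx e].

Definition upd_rob (p : pstate) (k : nat) (f : entry -> entry) : pstate :=
  set_rob p [seq if e_idx e == k then f e else e | e <- rob p].
Definition with_ex (x : status) (e : entry) : entry :=
  Entry (e_idx e) (e_pc e) (e_npc e) (e_ins e) x.
Definition with_ins (ins : robins) (x : status) (e : entry) : entry :=
  Entry (e_idx e) (e_pc e) (e_npc e) ins x.

Definition writes (e : entry) (r : Reg) : bool :=
  match e_ins e with
  | RNm _ _ dst _ => dst == r
  | RLd _ _ dst _ _ _ => dst == r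
  | _ => false
  end.

Definition dst_val (e : entry) : option Val :=
  match e_ins e with
  | RNm _ _ _ v => v
  | RLd _ _ _ _ v _ => v
  | _ => None
  end.

Definition src_val (p : pstate) (k : nat) (r : Reg) : option Val :=
  if [seq e <- older p k | writes e r] is e :: es
  then dst_val (last e es) else Some (rf p r).

(* All the sources of the entry k are ready, with values vs. *)
Definition ready (p : pstate) (k : nat) (srcs : seq Reg) (vs : seq Val) : Prop :=
  [seq src_val p k r | r <- srcs] = [seq Some v | v <- vs].

Definition ld_to (e : entry) (a : Addr) : bool :=
  if e_ins e is RLd _ _ _ a' _ _ then a' == Some a else false.
Definition st_to (e : entry) (a : Addr) : bool :=
  if e_ins e is RSt _ _ _ a' _ _ then a' == Some a else false.

Definition pending_ld (e : entry) : bool :=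
  match e_ins e, e_ex e with
  | RLd _ _ _ _ _ _, Exe => true
  | RLd _ _ _ _ _ _, ReEx => true
  | _, _ => false
  end.

Definition flush (k : nat) (pc : PC) (p : pstate) : pstate :=
  PState pc (rf p) (older p k) (sb p)
    (fun j => lf p j ||
       has (fun e => [&& e_idx e == j, k <= j & pending_ld e]) (rob p))
    (nxt p).

Inductive bypass : Type :=
| Found (v : Val) (t : tag)
| Blocked
| NotFound.

(* The entries es are listed from youngest to oldest; res is the answer when
   the search of es meets neither an executed store to a nor a Reconcile. *)
Fixpoint bypass_rob (es : seq entry) (a : Addr) (res : bypass) : bypass :=
  if es is e :: es' then
    match e_ins e, e_ex e with
    | RReconcile, _ => Blocked
    | RSt _ _ _ (Some a') (Some v) t, Done =>
        if a' == a then Found v t else bypass_rob es' a res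
    | _, _ => bypass_rob es' a res
    end
  else res.

Definition bypass_sb (ss : seq sbentry) (a : Addr) : bypass :=
  if [seq x <- rev ss | sb_a x == a] is x :: _
  then Found (sb_v x) (sb_t x) else NotFound.

Definition findBypass (p : pstate) (k : nat) (a : Addr) : bypass :=
  bypass_rob (rev (older p k)) a (bypass_sb (sb p) a).

Fixpoint affected (es : seq entry) (a : Addr) : seq nat :=
  if es is e :: es' then
    if st_to e a then [::]
    else if ld_to e a && ~~ is_idle (e_ex e) then e_idx e :: affected es' a
    else affected es' a
  else [::].

Definition findAffectedLd (p : pstate) (k : nat) (a : Addr) : seq nat :=
  affected (younger p k) a.

Definition stale_ld (e : entry) (a : Addr) (t : tag) : bool :=
  if e_ins e is RLd _ _ _ a' _ t' then
    [&& a' == Some a, is_done (e_ex e) & t' != Some t]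
  else false.

Fixpoint first_stale (es : seq entry) (a : Addr) (t : tag) : option nat :=
  if es is e :: es' then
    if st_to e a then None
    else if stale_ld e a t then Some (e_idx e)
    else first_stale es' a t
  else None.

Definition findStaleLd (p : pstate) (k : nat) (a : Addr) (t : tag) : option nat :=
  first_stale (younger p k) a t.

(* flush(k, rob[k].pc); there is always an entry k where this is used. *)
Definition flush_from (k : nat) (p : pstate) : pstate :=
  if rob_at p k is Some e then flush k (e_pc e) p else p.

Fixpoint kill_lds (ks : seq nat) (p : pstate) : pstate :=
  if ks is k :: ks' then
    if rob_at p k is Some e then
      if is_done (e_ex e) then flush_from k p
      else kill_lds ks' (upd_rob p k (with_ex ReEx))
    else p
  else p.

Definition respLd (k : nat) (res : Val) (t : tag) (p : pstate) : pstate :=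
  if lf p k then set_lf p [eta lf p with k |-> false]
  else if rob_at p k is Some e then
    match e_ins e, e_ex e with
    | RLd _ _ _ _ _ _, ReEx => upd_rob p k (with_ex Idle)
    | RLd addr srcs dst (Some a) _ _, _ =>
        let p' := upd_rob p k
          (with_ins (RLd addr srcs dst (Some a) (Some res) (Some t)) Done) in
        if findStaleLd p' k a t is Some j then flush_from j p' else p'
    | _, _ => p
    end
  else p.

Definition respSt (a : Addr) (p : pstate) : pstate :=
  set_sb p (rem_first (fun x => sb_a x == a) (sb p)).

Definition fetched_ins (i : proc) (k : nat) (ins : instr) : robins :=
  match ins with
  | Nm op srcs dst => RNm op srcs dst None
  | Ld addr srcs dst => RLd addr srcs dst None None None
  | St addr data srcs => RSt addr data srcs None None (inr (i, k))
  | Commit => RCommit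
  | Reconcile => RReconcile
  end.

Definition fetched_ex (ins : instr) : status :=
  match ins with
  | Commit | Reconcile => Done
  | _ => Idle
  end.

Definition rob_instr (ins : robins) : instr :=
  match ins with
  | RNm op srcs dst _ => Nm op srcs dst
  | RLd addr srcs dst _ _ _ => Ld addr srcs dst
  | RSt addr data srcs _ _ _ => St addr data srcs
  | RCommit => Commit
  | RReconcile => Reconcile
  end.

Definition commit_event (e : entry) (res : result) : event :=
  Event (e_pc e) (rob_instr (e_ins e)) res.

Inductive action : Type :=
| Internal
| Committed (ev : event)
| Request (r : memreq).

Inductive ooo_proc_step (P : program) (i : proc) (p : pstate) :
    action -> pstate -> Prop :=
| OOO_Fetch ins npc :
    ins = fetch P (pcr p) ->
    (if ins is Nm _ _ _ then True else npc = seqpc P (pcr p)) ->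
    ooo_proc_step P i p Internal
      (PState npc (rf p)
         (rcons (rob p) (Entry (nxt p) (pcr p) npc
                           (fetched_ins i (nxt p) ins) (fetched_ex ins)))
         (sb p) (lf p) (nxt p).+1)
| OOO_NmEx k e op srcs dst old vs nextpc val p' :
    rob_at p k = Some e ->
    e_ins e = RNm op srcs dst old ->
    e_ex e = Idle ->
    ready p k srcs vs ->
    op (e_pc e) vs = (nextpc, val) ->
    p' = upd_rob p k (fun _ =>
           Entry k (e_pc e) nextpc (RNm op srcs dst (Some val)) Done) ->
    ooo_proc_step P i p Internal
      (if nextpc == e_npc e then p' else flush k.+1 nextpc p')
| OOO_LdAddr k e addr srcs dst v t vs :
    rob_at p k = Some e ->
    e_ins e = RLd addr srcs dst None v t ->
    e_ex e = Idle ->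
    ready p k srcs vs ->
    ooo_proc_step P i p Internal
      (upd_rob p k (with_ins (RLd addr srcs dst (Some (addr vs)) v t) Idle))
| OOO_LdBypass k e addr srcs dst a v t vs res t' :
    rob_at p k = Some e ->
    e_ins e = RLd addr srcs dst (Some a) v t ->
    e_ex e = Idle ->
    ready p k srcs vs ->
    findBypass p k a = Found res t' ->
    ooo_proc_step P i p Internal
      (upd_rob p k
         (with_ins (RLd addr srcs dst (Some a) (Some res) (Some t')) Done))
| OOO_LdReq k e addr srcs dst a v t vs :
    rob_at p k = Some e ->
    e_ins e = RLd addr srcs dst (Some a) v t ->
    e_ex e = Idle ->
    ready p k srcs vs ->
    findBypass p k a = NotFound ->
    ~~ lf p k ->
    ooo_proc_step P i p (Request (ReqLd k a)) (upd_rob p k (with_ex Exe))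
| OOO_StEx k e addr data srcs olda oldv t vs a v p' :
    rob_at p k = Some e ->
    e_ins e = RSt addr data srcs olda oldv t ->
    e_ex e = Idle ->
    ready p k srcs vs ->
    a = addr vs ->
    v = data vs ->
    p' = upd_rob p k (with_ins (RSt addr data srcs (Some a) (Some v) t) Done) ->
    ooo_proc_step P i p Internal (kill_lds (findAffectedLd p k a) p')
| OOO_NmCom e es op srcs dst v :
    rob p = e :: es ->
    e_ins e = RNm op srcs dst (Some v) ->
    e_ex e = Done ->
    ooo_proc_step P i p (Committed (commit_event e (ResNm (e_npc e) v)))
      (set_rf (set_rob p es) [eta rf p with dst |-> v])
| OOO_LdCom e es addr srcs dst a v t :
    rob p = e :: es ->
    e_ins e = RLd addr srcs dst (Some a) (Some v) t ->
    e_ex e = Done ->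
    ooo_proc_step P i p (Committed (commit_event e (ResLd a v)))
      (set_rf (set_rob p es) [eta rf p with dst |-> v])
| OOO_RecCom e es :
    rob p = e :: es ->
    e_ins e = RReconcile ->
    e_ex e = Done ->
    ooo_proc_step P i p (Committed (commit_event e ResFence)) (set_rob p es)
| OOO_StCom e es addr data srcs a v t :
    rob p = e :: es ->
    e_ins e = RSt addr data srcs (Some a) (Some v) t ->
    e_ex e = Done ->
    ooo_proc_step P i p (Committed (commit_event e (ResSt a v)))
      (set_sb (set_rob p es) (rcons (sb p) (SbEntry a v t false)))
| OOO_ComCom e es :
    rob p = e :: es ->
    e_ins e = RCommit ->
    sb p = [::] ->
    ooo_proc_step P i p (Committed (commit_event e ResFence)) (set_rob p es)
| OOO_StReq a v t s1 s2 :
    sb p = s1 ++ SbEntry a v t false :: s2 ->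
    ~~ has (fun x => sb_a x == a) s1 ->
    ooo_proc_step P i p (Request (ReqSt a v t))
      (set_sb p (s1 ++ SbEntry a v t true :: s2)).

(* The order of the list [ccm_mrb i] is irrelevant. *)
Record ooo_state := OooState {
  ooo_procs : proc -> pstate;
  ccm_mem : Addr -> Val * tag;
  ccm_mrb : proc -> seq memreq
}.

Inductive ooo_ccm_step (P : proc -> program) (s : ooo_state) :
    option (proc * event) -> ooo_state -> Prop :=
| Proc_Internal i p :
    ooo_proc_step (P i) i (ooo_procs s i) Internal p ->
    ooo_ccm_step P s None
      (OooState [eta ooo_procs s with i |-> p] (ccm_mem s) (ccm_mrb s))
| Proc_Commit i ev p :
    ooo_proc_step (P i) i (ooo_procs s i) (Committed ev) p ->
    ooo_ccm_step P s (Some (i, ev))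
      (OooState [eta ooo_procs s with i |-> p] (ccm_mem s) (ccm_mrb s))
| Proc_Request i r p :
    ooo_proc_step (P i) i (ooo_procs s i) (Request r) p ->
    ooo_ccm_step P s None
      (OooState [eta ooo_procs s with i |-> p] (ccm_mem s)
         [eta ccm_mrb s with i |-> r :: ccm_mrb s i])
| CCM_Ld i k a r1 r2 v t :
    ccm_mrb s i = r1 ++ ReqLd k a :: r2 ->
    ccm_mem s a = (v, t) ->
    ooo_ccm_step P s None
      (OooState [eta ooo_procs s with i |-> respLd k v t (ooo_procs s i)]
         (ccm_mem s) [eta ccm_mrb s with i |-> r1 ++ r2])
| CCM_St i a v t r1 r2 :
    ccm_mrb s i = r1 ++ ReqSt a v t :: r2 ->
    ooo_ccm_step P s None
      (OooState [eta ooo_procs s with i |-> respSt a (ooo_procs s i)]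
         [eta ccm_mem s with a |-> (v, t)] [eta ccm_mrb s with i |-> r1 ++ r2]).

Definition ooo_ccm_init (I : init_state) : ooo_state :=
  OooState
    (fun i => PState (init_pc I i) (init_rf I i) [::] [::] (fun=> false) 0)
    (fun a => (init_mem I a, inl a))
    (fun=> [::]).

Definition ooo_ccm (P : proc -> program) (I : init_state) : model :=
  Model (ooo_ccm_init I) (ooo_ccm_step P)
    (fun s => forall i, sb (ooo_procs s i) = [::])
    (fun s a => (ccm_mem s a).1).

(* [cell_proc] is [None] for an initial value. *)
Record cell := Cell {
  cell_v : Val;
  cell_proc : option proc;
  cell_sts : nat;
  cell_mts : nat
}.

Record wsbentry := WSb {
  wsb_a : Addr;
  wsb_v : Val;
  wsb_sts : nat
}.

Record ibentry := Ib {
  ib_a : Addr;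
  ib_v : Val;
  ib_tsL : nat;
  ib_tsU : nat
}.

(* [w_sb] is listed from oldest to youngest; [w_ib] is unordered. *)
Record wproc := WProc {
  w_pc : PC;
  w_reg : Reg -> Val;
  w_regts : Reg -> nat;
  w_rts : nat;
  w_sb : seq wsbentry;
  w_ib : seq ibentry
}.

Definition ats (q : wproc) (srcs : seq Reg) : nat :=
  \max_(r <- srcs) w_regts q r.

Definition sb_has (q : wproc) (a : Addr) : bool :=
  has (fun x => wsb_a x == a) (w_sb q).

Definition drop_ib (q : wproc) (a : Addr) : seq ibentry :=
  [seq x <- w_ib q | ib_a x != a].

Definition write_reg (q : wproc) (pc : PC) (dst : Reg) (v : Val) (ts : nat)
    (ib : seq ibentry) : wproc :=
  WProc pc [eta w_reg q with dst |-> v] [eta w_regts q with dst |-> ts]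
    (w_rts q) (w_sb q) ib.

Inductive wmmd_exec (P : program) (i : proc) (gts : nat) (m : Addr -> cell)
    (q : wproc) : instr -> result -> wproc -> Prop :=
| W_Nm op srcs dst npc v :
    op (w_pc q) [seq w_reg q r | r <- srcs] = (npc, v) ->
    wmmd_exec P i gts m q (Nm op srcs dst) (ResNm npc v)
      (write_reg q npc dst v (ats q srcs) (w_ib q))
| W_LdSb addr srcs dst a s1 s2 v sts :
    a = addr [seq w_reg q r | r <- srcs] ->
    w_sb q = s1 ++ WSb a v sts :: s2 ->
    ~~ has (fun x => wsb_a x == a) s2 ->
    wmmd_exec P i gts m q (Ld addr srcs dst) (ResLd a v)
      (write_reg q (seqpc P (w_pc q)) dst v
         (maxn (maxn (ats q srcs) (w_rts q)) sts) (w_ib q))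
| W_LdMem addr srcs dst a vts :
    a = addr [seq w_reg q r | r <- srcs] ->
    ~~ sb_has q a ->
    vts = (if cell_proc (m a) == Some i then cell_sts (m a)
           else cell_mts (m a)) ->
    wmmd_exec P i gts m q (Ld addr srcs dst) (ResLd a (cell_v (m a)))
      (write_reg q (seqpc P (w_pc q)) dst (cell_v (m a))
         (maxn (maxn (ats q srcs) (w_rts q)) vts) (drop_ib q a))
(* An entry is inserted when the clock equals its ib_tsU. *)
| W_LdIb addr srcs dst a v tsL tsU b1 b2 :
    a = addr [seq w_reg q r | r <- srcs] ->
    ~~ sb_has q a ->
    w_ib q = b1 ++ Ib a v tsL tsU :: b2 ->
    ats q srcs <= tsU ->
    wmmd_exec P i gts m q (Ld addr srcs dst) (ResLd a v)
      (write_reg q (seqpc P (w_pc q)) dst v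
         (maxn (maxn (ats q srcs) (w_rts q)) tsL)
         [seq x <- w_ib q | ~~ ((ib_a x == a) && (ib_tsU x < tsU))])
| W_St addr data srcs a v :
    a = addr [seq w_reg q r | r <- srcs] ->
    v = data [seq w_reg q r | r <- srcs] ->
    wmmd_exec P i gts m q (St addr data srcs) (ResSt a v)
      (WProc (seqpc P (w_pc q)) (w_reg q) (w_regts q) (w_rts q)
         (rcons (w_sb q) (WSb a v (ats q srcs))) (drop_ib q a))
| W_Reconcile :
    wmmd_exec P i gts m q Reconcile ResFence
      (WProc (seqpc P (w_pc q)) (w_reg q) (w_regts q) gts (w_sb q) [::])
| W_Commit :
    w_sb q = [::] ->
    wmmd_exec P i gts m q Commit ResFence
      (WProc (seqpc P (w_pc q)) (w_reg q) (w_regts q) (w_rts q) (w_sb q)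
         (w_ib q)).

Record wmmd_state := WmmdState {
  w_gts : nat;
  w_mem : Addr -> cell;
  w_procs : proc -> wproc
}.

Definition ib_insert (x : ibentry) (q : wproc) : wproc :=
  WProc (w_pc q) (w_reg q) (w_regts q) (w_rts q) (w_sb q) (x :: w_ib q).

Definition dequeued (a : Addr) (q : wproc) : wproc :=
  WProc (w_pc q) (w_reg q) (w_regts q) (w_rts q)
    (rem_first (fun x => wsb_a x == a) (w_sb q)) (w_ib q).

(* The stale value that processor j sees when the content c of m[a] is
   overwritten at time gts. *)
Definition stale_entry (j : proc) (a : Addr) (c : cell) (gts : nat) : ibentry :=
  Ib a (cell_v c)
    (if cell_proc c == Some j then cell_sts c else cell_mts c) gts.

Inductive wmmd_step (P : proc -> program) (s : wmmd_state) :
    option (proc * event) -> wmmd_state -> Prop :=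
| W_Exec i ins res q :
    ins = fetch (P i) (w_pc (w_procs s i)) ->
    wmmd_exec (P i) i (w_gts s) (w_mem s) (w_procs s i) ins res q ->
    wmmd_step P s (Some (i, Event (w_pc (w_procs s i)) ins res))
      (WmmdState (w_gts s) (w_mem s) [eta w_procs s with i |-> q])
| W_Deq i a v sts s1 s2 :
    w_sb (w_procs s i) = s1 ++ WSb a v sts :: s2 ->
    ~~ has (fun x => wsb_a x == a) s1 ->
    wmmd_step P s None
      (WmmdState (w_gts s).+1
         [eta w_mem s with a |-> Cell v (Some i) sts (w_gts s).+1]
         (fun j =>
            if j == i then dequeued a (w_procs s i)
            else if sb_has (w_procs s j) a then w_procs s j
            else ib_insert (stale_entry j a (w_mem s a) (w_gts s))
                   (w_procs s j))).

Definition wmmd_init (I : init_state) : wmmd_state :=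
  WmmdState 0 (fun a => Cell (init_mem I a) None 0 0)
    (fun i => WProc (init_pc I i) (init_rf I i) (fun=> 0) 0 [::] [::]).

Definition wmmd (P : proc -> program) (I : init_state) : model :=
  Model (wmmd_init I) (wmmd_step P)
    (fun s => forall i, w_sb (w_procs s i) = [::])
    (fun s a => cell_v (w_mem s a)).

End Machines.

(* Main.v *)
(* A WMM-D execution is replayed by first fetching every instruction that it
   executes, with correct predictions, so that no flush ever occurs.  The replay
   then follows the WMM-D rules: an instruction commits when WMM-D executes it,
   and a store reaches the memory when WMM-D dequeues it.  An instruction of
   timestamp T executes while the WMM-D clock is T: at the commit slot if WMM-D
   executes it then, and otherwise just before the next dequeue, the instructions
   of each processor being taken in program order.  Executing at time T is
   possible because sources and the Reconcile fences before a load are not newer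
   than T; the value is right because the interval in which a load may see a store
   contains its timestamp.  No store kills a younger load, since a load is at
   least as new as the last older store to its address, and no returning load
   finds a stale younger one, since out-of-order loads from one address with no
   store in between read the same store. *)
Require Import Defs.
From mathcomp Require Import all_boot.
From mathcomp Require Import zify.
From Stdlib Require List.
From Stdlib Require Import FunctionalExtensionality.

Set Implicit Arguments.
Unset Strict Implicit.
Unset Printing Implicit Defensive.

Local Arguments Nm {Reg Addr PC Val} op srcs dst.
Local Arguments Ld {Reg Addr PC Val} addr srcs dst.
Local Arguments St {Reg Addr PC Val} addr data srcs.
Local Arguments Commit {Reg Addr PC Val}.
Local Arguments Reconcile {Reg Addr PC Val}.
Local Arguments ResNm {Addr PC Val} npc v.
Local Arguments ResLd {Addr PC Val} a v.
Local Arguments ResSt {Addr PC Val} a v.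
Local Arguments ResFence {Addr PC Val}.
Local Arguments RNm {Reg Addr PC Val n} op srcs dst val.
Local Arguments RLd {Reg Addr PC Val n} addr srcs dst a v t.
Local Arguments RSt {Reg Addr PC Val n} addr data srcs a v t.
Local Arguments RCommit {Reg Addr PC Val n}.
Local Arguments RReconcile {Reg Addr PC Val n}.
Local Arguments Internal {Reg Addr PC Val n}.
Local Arguments Committed {Reg Addr PC Val n} ev.
Local Arguments Request {Reg Addr PC Val n} r.
Local Arguments ReqLd {Addr Val n} idx a.

(** * Annotated histories and WMM-D with tagged stores *)

Section Simulation.

Variables (Reg Addr PC : eqType) (Val : Type) (n : nat).
Variable P : 'I_n -> program Reg Addr PC Val.
Variable I : init_state Reg Addr PC Val n.

Notation proc := 'I_n.
Notation tag := (Defs.tag Addr n).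
Notation instr := (instr Reg Addr PC Val).
Notation result := (result Addr PC Val).
Notation event := (event Reg Addr PC Val).

(* An instruction executed by WMM-D: [a_ts] is the timestamp of its result, [a_g]
   the clock when it was executed, and [a_tag] the tag of the store that it read
   or created (irrelevant otherwise). *)
Record ann := Ann {
  a_pc : PC;
  a_ins : instr;
  a_res : result;
  a_ts : nat;
  a_g : nat;
  a_tag : tag
}.

Definition ann_event (A : ann) : event := Event (a_pc A) (a_ins A) (a_res A).

Definition ann_npc (i : proc) (A : ann) : PC :=
  if a_res A is ResNm npc _ then npc else seqpc (P i) (a_pc A).

Definition ann_write (A : ann) : option (Reg * Val) :=
  match a_ins A, a_res A with
  | Nm _ _ dst, ResNm _ v => Some (dst, v)
  | Ld _ _ dst, ResLd _ v => Some (dst, v)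
  | _, _ => None
  end.

Definition ann_ld (A : ann) (a : Addr) : bool :=
  if a_res A is ResLd a' _ then a' == a else false.

Definition ann_st (A : ann) (a : Addr) : bool :=
  if a_res A is ResSt a' _ then a' == a else false.

Definition pc_of (i : proc) (h : seq ann) : PC :=
  foldl (fun _ A => ann_npc i A) (init_pc I i) h.

Definition reg_of (i : proc) (h : seq ann) : Reg -> Val :=
  foldl (fun f A => if ann_write A is Some (dst, v) then [eta f with dst |-> v]
                    else f) (init_rf I i) h.

Definition regts_of (h : seq ann) : Reg -> nat :=
  foldl (fun f A => if ann_write A is Some (dst, _)
                    then [eta f with dst |-> a_ts A] else f) (fun=> 0) h.

Definition vals (i : proc) (h : seq ann) (srcs : seq Reg) : seq Val :=
  [seq reg_of i h r | r <- srcs].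

Definition ats_of (h : seq ann) (srcs : seq Reg) : nat :=
  \max_(r <- srcs) regts_of h r.

Definition rec_of (h : seq ann) : nat :=
  foldl (fun m A => if a_ins A is Reconcile then maxn m (a_g A) else m) 0 h.

Definition lastst (h : seq ann) (a : Addr) : nat :=
  foldl (fun m A => if ann_st A a then a_ts A else m) 0 h.

Definition ldsince (h : seq ann) (a : Addr) : seq (nat * tag) :=
  foldl (fun l A => if ann_st A a then [::]
                    else if ann_ld A a then (a_ts A, a_tag A) :: l
                    else l) [::] h.

(** What a bypass search going back from the end of [h] should find, where [b] is the answer below
    the reorder buffer. *)
Definition look (b : Val * tag) (h : seq ann) (a : Addr) : Val * tag :=
  foldl (fun b A => if a_res A is ResSt a' v
                    then if a' == a then (v, a_tag A) else b else b) b h.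

(** This collects what the replay needs to know about one instruction. For a load, the bound by
    [lastst] prevents a kill by an older store, the bound by [rec_of] an unpassable Reconcile, and
    the clause on [ldsince] a flush by [findStaleLd]. The tag of a store contains its position in
    the history, which is its reorder buffer index because nothing is ever flushed. *)
Definition ann_ok (i : proc) (h : seq ann) (A : ann) : Prop :=
  [/\ a_pc A = pc_of i h, a_ins A = fetch (P i) (a_pc A), a_ts A <= a_g A &
  match a_ins A with
  | Nm op srcs dst => exists npc v,
      [/\ a_res A = ResNm npc v, op (a_pc A) (vals i h srcs) = (npc, v)
        & ats_of h srcs <= a_ts A]
  | Ld addr srcs dst => exists a v,
      [/\ a = addr (vals i h srcs), a_res A = ResLd a v, ats_of h srcs <= a_ts A &
       [/\ lastst h a <= a_ts A, rec_of h <= a_ts A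
        & forall T t, (T, t) \in ldsince h a -> a_ts A < T -> a_tag A = t]]
  | St addr data srcs =>
      [/\ a_res A = ResSt (addr (vals i h srcs)) (data (vals i h srcs)),
          ats_of h srcs <= a_ts A & a_tag A = inr (i, size h)]
  | Commit | Reconcile => a_res A = ResFence
  end].

Definition hist_ok (i : proc) (h : seq ann) : Prop :=
  forall h1 A h2, h = h1 ++ A :: h2 -> ann_ok i h1 A.

Record gsbe := Gsb { x_a : Addr; x_v : Val; x_sts : nat; x_t : tag }.

Record gcell := Gcell {
  c_v : Val; c_t : tag; c_p : option proc; c_sts : nat; c_mts : nat
}.

(* [gib a tsL tsU v t] says that the invalidation buffer has an entry
   <a, v, [tsL, tsU]> and that t is the tag of the store that wrote v. *)
Record gproc := GProc {
  hist : seq ann;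
  grts : nat;
  gsb : seq gsbe;
  gib : Addr -> nat -> nat -> Val -> tag -> Prop
}.

Record gstate := GState {
  gts : nat;
  gmem : Addr -> gcell;
  gp : proc -> gproc
}.

Definition yst (sb : seq gsbe) (a : Addr) : option gsbe :=
  ohead [seq x <- rev sb | x_a x == a].

Definition vis (i : proc) (c : gcell) : nat :=
  if c_p c == Some i then c_sts c else c_mts c.

(* The processor may read (v, t) from a; the store is visible to it at the times
   in [lo, hi]. *)
Definition rd (g : nat) (m : Addr -> gcell) (i : proc) (q : gproc) (a : Addr)
    (lo hi : nat) (v : Val) (t : tag) : Prop :=
  if yst (gsb q) a is Some x
  then [/\ lo = x_sts x, hi = g, v = x_v x & t = x_t x]
  else [/\ lo = vis i (m a), hi = g, v = c_v (m a) & t = c_t (m a)]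
       \/ gib q a lo hi v t.

(* WMM-D with tagged stores; [G_Ld] stands for its three load rules, according to
   the origin of the readable store. *)
Inductive gexec (i : proc) (g : nat) (m : Addr -> gcell) (q : gproc) :
    ann -> gproc -> Prop :=
| G_Nm op srcs dst npc v :
    fetch (P i) (pc_of i (hist q)) = Nm op srcs dst ->
    op (pc_of i (hist q)) (vals i (hist q) srcs) = (npc, v) ->
    let A := Ann (pc_of i (hist q)) (Nm op srcs dst) (ResNm npc v)
               (ats_of (hist q) srcs) g (inr (i, size (hist q))) in
    gexec i g m q A (GProc (rcons (hist q) A) (grts q) (gsb q) (gib q))
| G_Ld addr srcs dst a lo hi v t :
    fetch (P i) (pc_of i (hist q)) = Ld addr srcs dst ->
    a = addr (vals i (hist q) srcs) ->
    rd g m i q a lo hi v t ->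
    ats_of (hist q) srcs <= hi ->
    let A := Ann (pc_of i (hist q)) (Ld addr srcs dst) (ResLd a v)
               (maxn (maxn (ats_of (hist q) srcs) (grts q)) lo) g t in
    gexec i g m q A
      (GProc (rcons (hist q) A) (grts q) (gsb q)
         (fun a' L U v' t' => gib q a' L U v' t' /\
            (a' = a -> yst (gsb q) a = None -> hi <= U)))
| G_St addr data srcs a v :
    fetch (P i) (pc_of i (hist q)) = St addr data srcs ->
    a = addr (vals i (hist q) srcs) ->
    v = data (vals i (hist q) srcs) ->
    let A := Ann (pc_of i (hist q)) (St addr data srcs) (ResSt a v)
               (ats_of (hist q) srcs) g (inr (i, size (hist q))) in
    gexec i g m q A
      (GProc (rcons (hist q) A) (grts q)
         (rcons (gsb q) (Gsb a v (ats_of (hist q) srcs) (inr (i, size (hist q)))))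
         (fun a' L U v' t' => gib q a' L U v' t' /\ a' <> a))
| G_Reconcile :
    fetch (P i) (pc_of i (hist q)) = Reconcile ->
    let A := Ann (pc_of i (hist q)) Reconcile ResFence
               g g (inr (i, size (hist q))) in
    gexec i g m q A
      (GProc (rcons (hist q) A) g (gsb q) (fun _ _ _ _ _ => False))
| G_Commit :
    fetch (P i) (pc_of i (hist q)) = Commit ->
    gsb q = [::] ->
    let A := Ann (pc_of i (hist q)) Commit ResFence
               g g (inr (i, size (hist q))) in
    gexec i g m q A (GProc (rcons (hist q) A) (grts q) (gsb q) (gib q)).

Definition gdeq (g : nat) (m : Addr -> gcell) (i : proc) (a : Addr) (sb' : seq gsbe)
    (j : proc) (q : gproc) : gproc :=
  if j == i then GProc (hist q) (grts q) sb' (gib q)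
  else if yst (gsb q) a is Some _ then q
  else GProc (hist q) (grts q) (gsb q)
         (fun a' L U v t => gib q a' L U v t \/
            a' = a /\ [/\ L = vis j (m a), U = g, v = c_v (m a) & t = c_t (m a)]).

Inductive gstep (s : gstate) : gstate -> Prop :=
| G_Exec i A q :
    gexec i (gts s) (gmem s) (gp s i) A q ->
    gstep s (GState (gts s) (gmem s) [eta gp s with i |-> q])
| G_Deq i x s1 s2 :
    gsb (gp s i) = s1 ++ x :: s2 ->
    ~~ has (fun y => x_a y == x_a x) s1 ->
    gstep s
      (GState (gts s).+1
         [eta gmem s with x_a x |->
            Gcell (x_v x) (x_t x) (Some i) (x_sts x) (gts s).+1]
         (fun j => gdeq (gts s) (gmem s) i (x_a x) (s1 ++ s2) j (gp s j))).

Inductive greach (s : gstate) : gstate -> Prop :=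
| greach_refl : greach s s
| greach_step s' s'' : greach s s' -> gstep s' s'' -> greach s s''.

Definition ginit : gstate :=
  GState 0 (fun a => Gcell (init_mem I a) (inl a) None 0 0)
    (fun=> GProc [::] 0 [::] (fun _ _ _ _ _ => False)).

Lemma greach_trans s1 s2 s3 : greach s1 s2 -> greach s2 s3 -> greach s1 s3.
Proof. by move=> h12; elim=> // s s' _ IH st; apply: greach_step IH st. Qed.

(** * Invariants of tagged WMM-D *)

Lemma yst_cat s1 s2 a :
  yst (s1 ++ s2) a = if yst s2 a is Some y then Some y else yst s1 a.
Proof. by rewrite /yst rev_cat filter_cat; case: [seq _ <- rev s2 | _]. Qed.

Lemma yst1 x a : yst [:: x] a = if x_a x == a then Some x else None.
Proof. by rewrite /yst /=; case: ifP. Qed.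

Lemma yst_none s a : ~~ has (fun y => x_a y == a) s -> yst s a = None.
Proof.
rewrite -has_rev /yst; elim: (rev s) => //= x s' IH.
by rewrite negb_or => /andP[/negbTE -> /IH].
Qed.

Lemma regts_of_le g h r :
  all (fun A => a_ts A <= g) h -> regts_of h r <= g.
Proof.
elim/last_ind: h => // h A IH; rewrite all_rcons => /andP[leA /IH].
by rewrite /regts_of foldl_rcons; case: ann_write => //= -[dst v] /=; case: eqP.
Qed.

Lemma ats_of_le g h srcs :
  (forall r, regts_of h r <= g) -> ats_of h srcs <= g.
Proof. by move=> le_g; apply/bigmax_leqP_seq. Qed.

Lemma lastst_le g h a : all (fun A => a_ts A <= g) h -> lastst h a <= g.
Proof.
elim/last_ind: h => // h A IH; rewrite all_rcons => /andP[leA /IH].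
by rewrite /lastst foldl_rcons; case: ifP.
Qed.

Lemma ldsince_le g h a T t :
  all (fun A => a_ts A <= g) h -> (T, t) \in ldsince h a -> T <= g.
Proof.
elim/last_ind: h => // h A IH; rewrite all_rcons => /andP[leA /IH].
rewrite /ldsince foldl_rcons; case: ifP => // _; case: ifP => // _.
by move=> le_g; rewrite inE => /orP[/eqP[-> _] | /le_g].
Qed.

(** [R] stands for [rd] at address [a]. The fields [good_hi] and [good_rts] place the timestamp of a
    load inside the interval that it reads; [good_st] and [good_ld] yield the load conditions of
    [ann_ok]. The disjointness in [good_lt], together with [good_eq], restores [good_ld] after a
    load. *)
Record good (g rts : nat) (h : seq ann) (a : Addr)
    (R : nat -> nat -> Val -> tag -> Prop) : Prop := Good {
  good_hi lo hi v t : R lo hi v t -> lo <= hi <= g;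
  good_st lo hi v t : R lo hi v t -> lastst h a <= lo;
  good_ld lo hi v t T t' :
    R lo hi v t -> (T, t') \in ldsince h a -> lo < T -> t = t';
  good_lt lo hi v t lo' hi' v' t' :
    R lo hi v t -> R lo' hi' v' t' -> hi < hi' -> hi < lo';
  good_eq lo v t hi lo' v' t' : R lo hi v t -> R lo' hi v' t' -> t = t';
  good_rts lo hi v t : R lo hi v t -> rts <= hi
}.

(** [inv_sb] holds because a store purges the entries for its address and a dequeue adds none while
    a store to it is buffered. The strict bound in [inv_ib] separates stale values from current
    ones, whose intervals end at [g]. *)
Record inv (i : proc) (g : nat) (m : Addr -> gcell) (q : gproc) : Prop := Inv {
  inv_hist : hist_ok i (hist q);
  inv_ts : all (fun A => a_ts A <= g) (hist q);
  inv_g : all (fun A => a_g A <= g) (hist q);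
  inv_rec : rec_of (hist q) <= grts q;
  inv_rts : grts q <= g;
  inv_good a : good g (grts q) (hist q) a (rd g m i q a);
  inv_sb a L U v t : yst (gsb q) a -> ~ gib q a L U v t;
  inv_ib a L U v t : gib q a L U v t -> U < g
}.

Lemma hist_ok_rcons i h A : hist_ok i h -> ann_ok i h A -> hist_ok i (rcons h A).
Proof.
move=> okh okA h1 B h2; case/lastP: h2 => [|h2 C].
  by rewrite cats1 => /rcons_inj[<- <-].
by rewrite -rcons_cons -rcons_cat => /rcons_inj[eh _]; apply: okh eh.
Qed.

Lemma good_sub g rts h a (R R' : nat -> nat -> Val -> tag -> Prop) :
  (forall lo hi v t, R' lo hi v t -> R lo hi v t) ->
  good g rts h a R -> good g rts h a R'.
Proof.
move=> sub [hi st ld lt eq rtsP]; split.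
- by move=> lo hi' v t /sub; apply: hi.
- by move=> lo hi' v t /sub; apply: st.
- by move=> lo hi' v t T t' /sub; apply: ld.
- by move=> lo hi1 v t lo' hi' v' t' /sub r /sub; apply: lt r.
- by move=> lo v t hi' lo' v' t' /sub r /sub; apply: eq r.
- by move=> lo hi' v t /sub; apply: rtsP.
Qed.

Lemma good_other g rts h a A R :
  ann_st A a = false -> ann_ld A a = false ->
  good g rts h a R -> good g rts (rcons h A) a R.
Proof.
move=> nst nld [hi st ld lt eq rtsP]; split=> //.
- by rewrite /lastst foldl_rcons nst.
- by rewrite /ldsince foldl_rcons nst nld.
Qed.

Lemma rdE_sub g m i q q' a :
  yst (gsb q') a = yst (gsb q) a ->
  (forall L U v t, gib q' a L U v t -> gib q a L U v t) ->
  forall lo hi v t, rd g m i q' a lo hi v t -> rd g m i q a lo hi v t.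
Proof.
move=> e sub lo hi v t; rewrite /rd e; case: yst => //.
by case=> [| /sub]; [left | right].
Qed.

Lemma exec_inv i g m q A q' :
  inv i g m q -> gexec i g m q A q' -> inv i g m q'.
Proof.
move=> iq; have [ok ts gs rec rts gd sbP ibP] := iq.
have le_rts r : regts_of (hist q) r <= g by apply: regts_of_le.
case=> {A q'}.
- move=> op srcs dst npc v ef eop A; split=> //=.
  + apply: hist_ok_rcons => //; split=> //=; first exact: ats_of_le.
    by exists npc, v.
  + by rewrite all_rcons ts andbT; exact: ats_of_le.
  + by rewrite all_rcons gs /= leqnn.
  + by rewrite /rec_of foldl_rcons.
  + by move=> a; apply: good_other (gd a).
- move=> addr srcs dst a lo hi v t ef ea r le_hi A.
  have [/andP[lo_hi hi_g] rts_hi st_lo] :=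
    And3 (good_hi (gd a) r) (good_rts (gd a) r) (good_st (gd a) r).
  (* Each of the three terms of the maximum is at most [hi]: the sources by the guard of the load,
     the last Reconcile by [good_rts], and [lo] by [good_hi]. *)
  have ts_hi : a_ts A <= hi by rewrite /= !geq_max le_hi rts_hi lo_hi.
  split=> //=.
  + apply: hist_ok_rcons => //; split=> //=; first exact: leq_trans ts_hi hi_g.
    exists a, v; split=> //=; first by rewrite -maxnA leq_maxl.
    split; first exact: leq_trans st_lo (leq_maxr _ _).
      by rewrite (leq_trans rec) // maxnAC leq_maxr.
    move=> T t' inT ltT; apply: (good_ld (gd a) r inT).
    by apply: leq_ltn_trans ltT; apply: leq_maxr.
  + by rewrite all_rcons ts /= andbT; exact: leq_trans ts_hi hi_g.
  + by rewrite all_rcons gs /= leqnn.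
  + by rewrite /rec_of foldl_rcons.
  + move=> b; case: (eqVneq a b) => [eab|nab]; last first.
      apply: good_other; rewrite /A /ann_st /ann_ld //=; first exact: negbTE.
      by apply: good_sub (gd b); apply: rdE_sub => //= ???? [].
    subst b; set R' := rd _ _ _ _ _.
    have sub lo' hi' v' t' : R' lo' hi' v' t' -> rd g m i q a lo' hi' v' t'.
      by apply: rdE_sub => //= ???? [].
    have [Ghi Gst Gld Glt Geq Grts] := good_sub sub (gd a).
    split=> //=; first by rewrite /lastst foldl_rcons; apply: Gst.
    move=> lo' hi' v' t' T t'' r' ; rewrite /ldsince foldl_rcons /=.
    rewrite {1}/ann_ld {1}/ann_st /= eqxx inE.
    move=> /orP[/eqP[-> ->] ltT|]; last exact: Gld r'.
    have rr := sub _ _ _ _ r'.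
    case ey: (yst (gsb q) a) => [y|].
      by move: r rr; rewrite /rd ey => -[_ _ _ ->] [_ _ _ ->].
    (* Whatever survives the purge ends no earlier than the interval just read. An equal end means
       the same store; a later end forces a start beyond [hi], hence beyond the timestamp of the
       load, against [ltT]. *)
    have le' : hi <= hi'.
      move: r'; rewrite /R' /rd /= ey => -[[_ -> _ _] // | [_]]; exact.
    move: le'; rewrite leq_eqVlt => /orP[/eqP e|lth].
      by rewrite -e in rr; apply: (good_eq (gd a) rr r).
    by have := good_lt (gd a) r rr lth; lia.
  + by move=> b L U v' t' /sbP nib [] /nib.
  + by move=> b L U v' t' [/ibP].
- move=> addr data srcs a v ef ea ev A; split=> //=.
  + apply: hist_ok_rcons => //; split=> //=; first exact: ats_of_le.
    by rewrite ea ev; split.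
  + by rewrite all_rcons ts andbT; exact: ats_of_le.
  + by rewrite all_rcons gs /= leqnn.
  + by rewrite /rec_of foldl_rcons.
  + move=> b; case: (eqVneq a b) => [<-|nab]; last first.
      apply: good_other; rewrite /A /ann_st /ann_ld //=; first exact: negbTE.
      apply: good_sub (gd b); apply: rdE_sub => /= [|???? []] //.
      by rewrite -cats1 yst_cat yst1 /= (negbTE nab).
    (* The new store hides every other one at its address, and [lastst] and [ldsince] are reset
       accordingly. *)
    set R' := rd _ _ _ _ _.
    have RE lo' hi' v' t' : R' lo' hi' v' t' ->
        [/\ lo' = ats_of (hist q) srcs, hi' = g & t' = inr (i, size (hist q))].
      by rewrite /R' /rd /= -cats1 yst_cat yst1 /= eqxx => -[].
    split.
    * by move=> lo hi v' t /RE[-> -> _]; rewrite leqnn andbT ats_of_le.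
    * move=> lo hi v' t /RE[-> _ _].
      by rewrite /lastst foldl_rcons {1}/ann_st /= eqxx.
    * by move=> lo hi v' t T t' _; rewrite /ldsince foldl_rcons {1}/ann_st /= eqxx.
    * by move=> lo hi v' t lo' hi' v'' t' /RE[_ -> _] /RE[_ -> _]; rewrite ltnn.
    * by move=> lo v' t hi lo' v'' t' /RE[_ _ ->] /RE[].
    * by move=> lo hi v' t /RE[_ -> _].
  + move=> b L U v' t'; rewrite -cats1 yst_cat yst1 /=.
    by case: eqP => [-> _ [] | _ /sbP nib [/nib]].
  + by move=> b L U v' t' [/ibP].
- move=> ef A; split=> //=.
  + by apply: hist_ok_rcons => //; split.
  + by rewrite all_rcons ts /= leqnn.
  + by rewrite all_rcons gs /= leqnn.
  + by rewrite /rec_of foldl_rcons /= geq_max leqnn (leq_trans rec).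
  + move=> a; apply: good_other => //; set R' := rd _ _ _ _ _.
    have sub lo' hi' v' t' : R' lo' hi' v' t' -> rd g m i q a lo' hi' v' t'.
      exact: rdE_sub.
    have [Ghi Gst Gld Glt Geq Grts] := good_sub sub (gd a).
    (* With the invalidation buffer emptied, every remaining interval ends at the clock, which is
       also the new [grts]. *)
    split=> // lo hi v t; rewrite /R' /rd /=.
    by case: yst => [y|]; [case=> _ -> | case=> [[_ -> _ _] |]].
  + by move=> a L U v t _ [].
- move=> ef esb A; split=> //=.
  + by apply: hist_ok_rcons => //; split.
  + by rewrite all_rcons ts /= leqnn.
  + by rewrite all_rcons gs /= leqnn.
  + by rewrite /rec_of foldl_rcons.
  + by move=> a; apply: good_other (gd a).
Qed.

(** All old intervals and all timestamps of the history end by [g], so the added interval, which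
    starts at [g.+1], lies beyond them. *)
Lemma good_new g rts h a (R R' : nat -> nat -> Val -> tag -> Prop) v0 t0 :
  all (fun A => a_ts A <= g) h -> rts <= g ->
  (forall lo hi v t, R' lo hi v t ->
     R lo hi v t \/ [/\ lo = g.+1, hi = g.+1, v = v0 & t = t0]) ->
  good g rts h a R -> good g.+1 rts h a R'.
Proof.
move=> tsP rtsP sub [Ghi Gst Gld Glt Geq Grts]; split.
- move=> lo hi v t /sub[/Ghi/andP[-> le_hi]|[-> -> _ _]]; last by rewrite !leqnn.
  exact: leqW.
- move=> lo hi v t /sub[/Gst //|[-> _ _ _]].
  by apply: leqW; apply: lastst_le.
- move=> lo hi v t T t' /sub[/Gld r /r //|[-> _ _ _]] /(ldsince_le tsP) le_T.
  lia.
- move=> lo hi v t lo' hi' v' t' /sub[r|[_ -> _ _]] /sub[r'|[-> -> _ _]].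
  + exact: Glt r r'.
  + by move=> _; have := Ghi _ _ _ _ r; lia.
  + by have := Ghi _ _ _ _ r'; lia.
  + by rewrite ltnn.
- move=> lo v t hi lo' v' t' /sub[r|[_ -> _ ->]] /sub[r'|[_ e _ ->]] //.
  + exact: Geq r r'.
  + by have := Ghi _ _ _ _ r; lia.
  + by have := Ghi _ _ _ _ r'; lia.
- by move=> lo hi v t /sub[/Grts // | [_ -> _ _]]; apply: leqW.
Qed.

(** A right end equal to the clock belongs to a store that is still current for the processor and
    moves with the clock; any other end is frozen. *)
Definition bump (g hi : nat) : nat := if hi == g then g.+1 else hi.

(** No right end exceeds [g], and below that bound [bump g] is injective and preserves the order. *)
Lemma good_bump g rts h a (R R' : nat -> nat -> Val -> tag -> Prop) :
  (forall lo hi' v t, R' lo hi' v t -> exists2 hi, R lo hi v t & hi' = bump g hi) ->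
  good g rts h a R -> good g.+1 rts h a R'.
Proof.
move=> sub [Ghi Gst Gld Glt Geq Grts].
split; rewrite /bump in sub *.
- by move=> lo hi' v t /sub[hi /Ghi le_hi ->]; case: eqP; lia.
- by move=> lo hi' v t /sub[hi /Gst].
- by move=> lo hi' v t T t' /sub[hi /Gld r _] /r.
- move=> lo hi v t lo' hi' v' t' /sub[k r ->] /sub[k' r' ->].
  have := Ghi _ _ _ _ r; have := Ghi _ _ _ _ r'; have := Glt _ _ _ _ _ _ _ _ r r'.
  by case: eqP; case: eqP; lia.
- move=> lo v t hi lo' v' t' /sub[k r ->] /sub[k' r'].
  have := Ghi _ _ _ _ r; have := Ghi _ _ _ _ r' => le le' e.
  have e' : k = k' by move: e; case: eqP; case: eqP; lia.
  by rewrite -e' in r'; apply: Geq r r'.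
- by move=> lo hi' v t /sub[hi /Grts le ->]; case: eqP; lia.
Qed.

Definition deq_mem (g : nat) (m : Addr -> gcell) (i : proc) (x : gsbe) :=
  [eta m with x_a x |-> Gcell (x_v x) (x_t x) (Some i) (x_sts x) g.+1].

Lemma yst_deq s1 x s2 a :
  ~~ has (fun y => x_a y == x_a x) s1 ->
  yst (s1 ++ x :: s2) a =
    if yst (s1 ++ s2) a is Some y then Some y
    else if x_a x == a then Some x else None.
Proof.
move=> no; rewrite -cat1s !yst_cat yst1.
case: (yst s2 a) => // ; case: eqP => [<-|_]; first by rewrite yst_none.
by case: yst.
Qed.

(* In the second case the overwritten value stays readable through the
   invalidation buffer, with the same bounds. *)
Lemma rd_deq g m i x s1 s2 j q a :
  (j = i -> gsb q = s1 ++ x :: s2) ->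
  ~~ has (fun y => x_a y == x_a x) s1 ->
  inv j g m q ->
  let R := rd g m j q a in
  let R' := rd g.+1 (deq_mem g m i x) j (gdeq g m i (x_a x) (s1 ++ s2) j q) a in
  (forall lo hi' v t, R' lo hi' v t -> exists2 hi, R lo hi v t & hi' = bump g hi) \/
  (forall lo hi v t, R' lo hi v t ->
     R lo hi v t \/ [/\ lo = g.+1, hi = g.+1, v = x_v x & t = x_t x]).
Proof.
move=> esb no iq R R'; rewrite /R /R' /rd /gdeq /bump.
have hib L U v t : gib q a L U v t -> U = (if U == g then g.+1 else U).
  by move=> /(inv_ib iq); case: eqP; lia.
case: (eqVneq j i) => [eji|nji] /=.
  left=> lo hi' v t; have := @inv_sb _ _ _ _ iq a; rewrite (esb eji) yst_deq //.
  case: yst => [y _ [-> -> -> ->]|]; first by exists g; rewrite ?eqxx.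
  (* If this was the last buffered store to [a], the processor now reads it from memory. Being its
     own store, it stays visible from its creation timestamp, so the left end does not change. *)
  rewrite [a == _]eq_sym; case: eqP => [_ nib|_ _] /=.
    case=> [[-> -> -> ->]|/nib []//]; exists g; rewrite ?eqxx //.
    by rewrite /vis /= eji eqxx.
  case=> [[-> -> -> ->]|ib]; first by exists g; rewrite ?eqxx //; left.
  by exists hi'; [right | exact: hib ib].
case: (eqVneq a (x_a x)) => [ea|na]; last first.
  left=> lo hi' v t; case ex: (yst (gsb q) (x_a x)) => [y|] /=.
    case: yst => [z [-> -> -> ->]|]; first by exists g; rewrite ?eqxx.
    case=> [[-> -> -> ->]|ib]; first by exists g; rewrite ?eqxx //; left.
    by exists hi'; [right | exact: hib ib].
  case: yst => [z [-> -> -> ->]|]; first by exists g; rewrite ?eqxx.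
  case=> [[-> -> -> ->]|[ib|[]// /eqP]]; first by exists g; rewrite ?eqxx //; left.
    by exists hi'; [right | exact: hib ib].
  by rewrite (negbTE na).
rewrite ea; case ex: (yst (gsb q) (x_a x)) => [y|] /=.
  by left=> lo hi' v t; rewrite ex => -[-> -> -> ->]; exists g; rewrite ?eqxx.
right=> lo hi v t; rewrite ex {1}/vis /=.
have -> : (Some i == Some j) = false by apply/eqP => -[/esym/eqP]; apply/negP.
by case=> [[-> -> -> ->]|[ib|[_ [-> -> -> ->]]]]; [right | left; right | left; left].
Qed.

Lemma deq_inv g m i x s1 s2 j q :
  (j = i -> gsb q = s1 ++ x :: s2) ->
  ~~ has (fun y => x_a y == x_a x) s1 ->
  inv j g m q ->
  inv j g.+1 (deq_mem g m i x) (gdeq g m i (x_a x) (s1 ++ s2) j q).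
Proof.
move=> esb no iq; have [ok ts gs rec rts gd sbP ibP] := iq.
set q' := gdeq _ _ _ _ _ _ _.
have eh : hist q' = hist q by rewrite /q' /gdeq; case: eqP => // _; case: yst.
have er : grts q' = grts q by rewrite /q' /gdeq; case: eqP => // _; case: yst.
split; rewrite ?eh ?er //.
- by apply: sub_all ts => A /= leA; apply: leqW.
- by apply: sub_all gs => A /= leA; apply: leqW.
- exact: leqW.
- move=> a; have [bp|nw] := @rd_deq g m i x s1 s2 j q a esb no iq.
    exact: good_bump bp (gd a).
  exact: good_new ts rts nw (gd a).
- move=> a L U v t; rewrite /q' /gdeq; case: eqP => [eji|_] /=.
    have := sbP a L U v t; rewrite (esb eji) yst_deq //.
    by case: yst => // y nib _; apply: nib.
  case ex: (yst (gsb q) (x_a x)) => [y|] /=; first exact: sbP.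
  by move=> sa [/(sbP _ _ _ _ _ sa)//|[ea _]]; rewrite ea ex in sa.
- move=> a L U v t; rewrite /q' /gdeq; case: eqP => _ /=.
    by move/ibP/leqW.
  case: yst => [y|] /=; first by move/ibP/leqW.
  by case=> [/ibP/leqW //|[_ [_ -> _ _]]].
Qed.

Definition ginv (s : gstate) : Prop :=
  forall i, inv i (gts s) (gmem s) (gp s i).

Lemma step_inv s s' : ginv s -> gstep s s' -> ginv s'.
Proof.
move=> inv_s [i A q ex|i x s1 s2 esb no] j /=.
  by case: eqP => [->|_]; [apply: exec_inv (inv_s i) ex | apply: inv_s].
by apply: deq_inv => // ->.
Qed.

Lemma init_inv : ginv ginit.
Proof.
move=> i; split=> //=; first by move=> [].
move=> a; set R := rd _ _ _ _ _.
have RE lo hi v t : R lo hi v t -> [/\ lo = 0, hi = 0 & t = inl a].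
  by case=> // -[-> -> _ ->].
split=> //.
- by move=> lo hi v t /RE[-> ->].
- by move=> lo hi v t lo' hi' v' t' /RE[_ -> _] /RE[_ ->].
- by move=> lo v t hi lo' v' t' /RE[_ _ ->] /RE[_ _ ->].
Qed.

Lemma reach_inv s s' : ginv s -> greach s s' -> ginv s'.
Proof. by move=> i0; elim=> // s1 s2 _ /step_inv st /st. Qed.

(** * Reading at an earlier time *)

(** An instruction acts on the readable stores as it acts on [look]: it adds none, or it is a store
    to [b] that hides all others. This is the inductive step of [reach_look]. *)
Lemma exec_rd i g m q A q' b :
  gexec i g m q A q' ->
  (ann_st A b = false /\
   forall lo hi v t, rd g m i q' b lo hi v t -> rd g m i q b lo hi v t) \/
  (exists2 v, a_res A = ResSt b v &
   forall lo hi v' t', rd g m i q' b lo hi v' t' -> (v', t') = (v, a_tag A)).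
Proof.
case=> {A q'} [op srcs dst npc v _ _|addr srcs dst a lo hi v t _ _ _ _||_|_ _] //=;
  try by left.
- by left; split=> //; apply: rdE_sub => //= ???? [].
- move=> addr data srcs a v _ _ _; case: (eqVneq a b) => [<-|nab].
    right; exists v => //= lo hi v' t'.
    by rewrite /rd /= -cats1 yst_cat yst1 /= eqxx => -[_ _ -> ->].
  left; rewrite /ann_st /= (negbTE nab); split=> //.
  apply: rdE_sub => /= [|???? []] //.
  by rewrite -cats1 yst_cat yst1 /= (negbTE nab).
- by left; split=> //; apply: rdE_sub.
Qed.

Lemma exec_hist i g m q A q' :
  gexec i g m q A q' -> hist q' = rcons (hist q) A /\ a_g A = g.
Proof. by case. Qed.

Lemma exec_ld i g m q A q' a v :
  inv i g m q -> gexec i g m q A q' -> a_res A = ResLd a v ->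
  exists lo hi, rd g m i q a lo hi v (a_tag A) /\ lo <= a_ts A <= hi.
Proof.
move=> iq; case=> {A q'} // addr srcs dst a' lo hi v' t _ _ r le_hi /= [ea ev].
rewrite {}ea {}ev in r *; exists lo, hi; split=> //.
have := good_hi (inv_good iq a) r; have := good_rts (inv_good iq a) r.
lia.
Qed.

Lemma gdeq_hist g m i a sb' j q : hist (gdeq g m i a sb' j q) = hist q.
Proof. by rewrite /gdeq; case: eqP => // _; case: yst. Qed.

(** The bound on [a_g] later shows that no Reconcile lies between the commit slot and a load that
    executes early. *)
Lemma reach_hist s s' i :
  greach s s' ->
  exists l, [/\ hist (gp s' i) = hist (gp s i) ++ l,
                all (fun A => gts s <= a_g A) l & gts s <= gts s'].
Proof.
elim=> [|s1 s2 _ [l [eh lg le_g]]]; first by exists [::]; rewrite cats0.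
case=> [j A q ex|j x t1 t2 _ _] /=.
  case: eqP => [eij|_]; last by exists l.
  rewrite -{}eij {j} in ex; have [eq eg] := exec_hist ex; exists (rcons l A).
  by rewrite eq all_rcons eg lg le_g -rcons_cat -eh.
by exists l; rewrite gdeq_hist; split=> //; apply: leqW.
Qed.

(** The starting value for [look]: what the out-of-order processor obtains once its search has left
    the reorder buffer. *)
Definition base (s : gstate) (i : proc) (a : Addr) : Val * tag :=
  if yst (gsb (gp s i)) a is Some x then (x_v x, x_t x)
  else (c_v (gmem s a), c_t (gmem s a)).

Lemma look_rcons b l A a :
  look b (rcons l A) a =
    if a_res A is ResSt a' v
    then if a' == a then (v, a_tag A) else look b l a else look b l a.
Proof. by rewrite /look foldl_rcons. Qed.

Lemma look_nst b l A a : ann_st A a = false -> look b (rcons l A) a = look b l a.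
Proof. by rewrite look_rcons /ann_st; case: (a_res A) => // a' v ->. Qed.

(* This is what allows a load with timestamp [gts s] to execute already in s. *)
Lemma reach_look s s' i :
  ginv s -> greach s s' ->
  exists l, [/\ hist (gp s' i) = hist (gp s i) ++ l,
   forall a lo hi v t, rd (gts s') (gmem s') i (gp s' i) a lo hi v t ->
     lo <= gts s -> gts s <= hi -> (v, t) = look (base s i a) l a
   & forall l1 A l2 a v, l = l1 ++ A :: l2 -> a_res A = ResLd a v ->
     a_ts A = gts s -> (v, a_tag A) = look (base s i a) l1 a].
Proof.
move=> inv_s; elim=> [|s1 s2 rch [l [eh rdP ldP]]].
  exists [::]; rewrite cats0; split=> // [a lo hi v t|[]//].
  rewrite /rd /base; case: yst => [x [_ _ -> ->] //|[[_ _ -> ->] //|]].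
  (* Stale intervals end strictly before the clock of [s], so only the current value contains it. *)
  by move/(inv_ib (inv_s i)); lia.
have le_g : gts s <= gts s1 by have [? []] := reach_hist i rch.
have inv1 := reach_inv inv_s rch.
case=> [j A q ex|j x t1 t2 esb no] /=; last first.
  exists l; rewrite gdeq_hist; split=> // a lo hi' v t r le_lo le_hi.
  have esb' : i = j -> gsb (gp s1 i) = t1 ++ x :: t2 by move=> ->.
  (* Bumping does not affect whether an interval contains [gts s], which is at most the clock before
     the dequeue; an interval opened by the dequeue starts too late to contain it. *)
  have [bp|nw] := rd_deq a esb' no (inv1 i).
    have [hi r' ehi] := bp _ _ _ _ r; apply: rdP r' le_lo _.
    by move: ehi le_hi; rewrite /bump; case: eqP; lia.
  by have [r'|[elo _ _ _]] := nw _ _ _ _ r; [apply: rdP r' le_lo le_hi | lia].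
case: eqP => [eij|_]; last by exists l.
rewrite -{}eij {j} in ex.
have [eq eg] := exec_hist ex; exists (rcons l A).
rewrite eq -rcons_cat -eh; split=> //.
- move=> a lo hi v t r le_lo le_hi.
  have [[nst sub]|[v' eres st]] := exec_rd a ex.
    by rewrite look_nst //; apply: rdP le_lo le_hi; apply: sub.
  by rewrite look_rcons eres eqxx; apply: st r.
- move=> l1 B l2 a v; case/lastP: l2 => [|l2 C]; last first.
    by rewrite -rcons_cons -rcons_cat => /rcons_inj[/ldP el _]; apply: el.
  rewrite cats1 => /rcons_inj[<- <-] eres ets.
  have [lo [hi [r /andP[le_lo le_hi]]]] := exec_ld (inv1 i) ex eres.
  by apply: rdP r _ _; rewrite -ets.
Qed.

(** * Tagging WMM-D executions *)

Lemma In_filter (T : Type) (p : pred T) x s :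
  List.In x (filter p s) -> List.In x s /\ p x.
Proof.
elim: s => //= y s IH; case: ifP => [py /= [<-|/IH[]]|_ /IH[]]; last 2 first.
- by split; [right |].
- by split; [right |].
by split; [left |].
Qed.

Lemma map_split (T U : Type) (f : T -> U) l s1 x s2 :
  map f l = s1 ++ x :: s2 ->
  exists l1 y l2, [/\ l = l1 ++ y :: l2, map f l1 = s1, f y = x & map f l2 = s2].
Proof.
elim: s1 l => [|z s1 IH] [|y l] //= [ey].
  by move=> el; exists [::], y, l.
by move=> /IH[l1 [y' [l2 [-> <- <- <-]]]]; exists (y :: l1), y', l2; rewrite -ey.
Qed.

Definition erase_sb (x : gsbe) : wsbentry Addr Val := WSb (x_a x) (x_v x) (x_sts x).

(** For the invalidation buffer an inclusion is enough, since more tagged entries only give the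
    tagged loads more choice. WMM-D has no tags, hence the existential. *)
Record relp (i : proc) (q : gproc) (w : wproc Reg Addr PC Val) : Prop := Relp {
  rel_pc : w_pc w = pc_of i (hist q);
  rel_reg : w_reg w =1 reg_of i (hist q);
  rel_regts : w_regts w =1 regts_of (hist q);
  rel_rts : w_rts w = grts q;
  rel_sb : w_sb w = map erase_sb (gsb q);
  rel_ib x : List.In x (w_ib w) ->
    exists t, gib q (ib_a x) (ib_tsL x) (ib_tsU x) (ib_v x) t
}.

Definition erase_cell (c : gcell) : cell Val n :=
  Cell (c_v c) (c_p c) (c_sts c) (c_mts c).

Record rel (gs : gstate) (s : wmmd_state Reg Addr PC Val n) : Prop := Rel {
  rel_gts : w_gts s = gts gs;
  rel_mem a : w_mem s a = erase_cell (gmem gs a);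
  rel_procs i : relp i (gp gs i) (w_procs s i)
}.

Lemma rel_vals i q w srcs :
  relp i q w -> [seq w_reg w r | r <- srcs] = vals i (hist q) srcs.
Proof. by move=> r; apply: eq_map => x; apply: rel_reg. Qed.

Lemma rel_ats i q w srcs : relp i q w -> ats w srcs = ats_of (hist q) srcs.
Proof. by move=> r; apply: eq_bigr => x _; apply: rel_regts r x. Qed.

Lemma rel_sb_has i q w a : relp i q w -> ~~ sb_has w a -> yst (gsb q) a = None.
Proof. by move=> r; rewrite /sb_has (rel_sb r) has_map => /yst_none. Qed.

Lemma pc_rcons i h A : pc_of i (rcons h A) = ann_npc i A.
Proof. by rewrite /pc_of foldl_rcons. Qed.

Lemma reg_rcons i h A :
  reg_of i (rcons h A) = if ann_write A is Some (dst, v)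
                         then [eta reg_of i h with dst |-> v] else reg_of i h.
Proof. by rewrite /reg_of foldl_rcons. Qed.

Lemma regts_rcons h A :
  regts_of (rcons h A) = if ann_write A is Some (dst, v)
                         then [eta regts_of h with dst |-> a_ts A] else regts_of h.
Proof. by rewrite /regts_of foldl_rcons. Qed.

Lemma lift_exec i g m q w (wm : Addr -> cell Val n) ins res w' :
  relp i q w -> inv i g m q -> (forall a, wm a = erase_cell (m a)) ->
  ins = fetch (P i) (w_pc w) ->
  wmmd_exec (P i) i g wm w ins res w' ->
  exists A q', [/\ gexec i g m q A q', relp i q' w'
                 & ann_event A = Event (w_pc w) ins res].
Proof.
move=> r iq em ei ex; have [epc ereg erts ert esb eib] := r.
have le_ats srcs : ats_of (hist q) srcs <= g.
  by apply: ats_of_le => x; apply: regts_of_le (inv_ts iq).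
have wr A dst v pc ts ib q' :
    hist q' = rcons (hist q) A ->
    ann_write A = Some (dst, v) -> pc = ann_npc i A -> ts = a_ts A ->
    grts q' = grts q -> gsb q' = gsb q ->
    (forall x, List.In x ib ->
       exists t, gib q' (ib_a x) (ib_tsL x) (ib_tsU x) (ib_v x) t) ->
    relp i q' (write_reg w pc dst v ts ib).
  move=> eh ew epc' ets er es ib'; split=> //=.
  - by rewrite eh pc_rcons.
  - by move=> x; rewrite eh reg_rcons ew /= ereg.
  - by move=> x; rewrite eh regts_rcons ew /= erts ets.
  - by rewrite er.
  - by rewrite es.
(* The three load rules share this argument: [hi] is the clock for a value from the store buffer or
   from memory, and the end of the entry for a stale value. *)
have ld addr srcs dst a lo hi v t ib :
    fetch (P i) (w_pc w) = Ld addr srcs dst ->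
    a = addr [seq w_reg w r | r <- srcs] ->
    rd g m i q a lo hi v t -> ats w srcs <= hi ->
    (forall x, List.In x ib -> List.In x (w_ib w) /\
       (ib_a x = a -> yst (gsb q) a = None -> hi <= ib_tsU x)) ->
    exists A q', [/\ gexec i g m q A q',
      relp i q' (write_reg w (seqpc (P i) (w_pc w)) dst v
                   (maxn (maxn (ats w srcs) (w_rts w)) lo) ib)
    & ann_event A = Event (w_pc w) (Ld addr srcs dst) (ResLd a v)].
  move=> ef ea rda le_hi ibP; rewrite epc in ef.
  rewrite (rel_vals _ r) in ea; rewrite (rel_ats _ r) in le_hi *.
  do 2!eexists; split; first exact: G_Ld ef ea rda le_hi.
  - apply: wr; [exact: erefl | exact: erefl | by rewrite /ann_npc /= epc
               | by rewrite ert | by [] | by [] |].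
    by move=> x /ibP[/eib[t' gx] hiP]; exists t'.
  - by rewrite /ann_event /= epc.
case: ex ei => {ins res w'}.
- move=> op srcs dst npc v eop ef; rewrite epc in ef eop.
  rewrite (rel_vals _ r) in eop; rewrite (rel_ats _ r).
  do 2!eexists; split; first exact: G_Nm (esym ef) eop.
    by apply: wr; [exact: erefl | exact: erefl | ..].
  by rewrite /ann_event /= epc.
- move=> addr srcs dst a s1 s2 v sts ea es no ef.
  rewrite esb in es; have [l1 [[a' v' sts' t] [l2 [el _ [? ? ?] el2]]]] := map_split es.
  subst a' v' sts'; have ey : yst (gsb q) a = Some (Gsb a v sts t).
    by rewrite el -cat1s !yst_cat yst1 /= eqxx yst_none //; move: no; rewrite -el2 has_map.
  apply: (ld _ _ _ _ _ g _ t) => //; first by rewrite /rd ey.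
    by rewrite (rel_ats _ r).
  by move=> x inx; split=> //; rewrite ey.
- move=> addr srcs dst a vts ea no evts ef; have ey := rel_sb_has r no.
  apply: (ld _ _ _ _ _ g _ (c_t (m a))) => //.
  + by rewrite /rd ey; left; rewrite em evts em.
  + by rewrite (rel_ats _ r).
  + by move=> x inx; have [? /eqP] := In_filter inx.
- move=> addr srcs dst a v L U b1 b2 ea no eb le_U ef; have ey := rel_sb_has r no.
  have [|t gx] := eib (Ib a v L U).
    by rewrite eb; apply/List.in_or_app; right; left.
  apply: (ld _ _ _ _ _ U _ t) => //; first by rewrite /rd ey; right.
  move=> x inx; have [inx'] := In_filter inx.
  rewrite negb_and -leqNgt => h; split=> // xa _.
  by move: h; rewrite xa eqxx.
- move=> addr data srcs a v ea ev ef; rewrite epc in ef.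
  rewrite (rel_vals _ r) in ea ev; rewrite (rel_ats _ r).
  do 2!eexists; split; first exact: G_St (esym ef) ea ev.
    split=> //=.
    + by rewrite pc_rcons /ann_npc /= epc.
    + by rewrite reg_rcons.
    + by rewrite regts_rcons.
    + by rewrite map_rcons esb.
    + by move=> x inx; have [/eib[t gx] /eqP na] := In_filter inx; exists t.
  by rewrite /ann_event /= epc.
- move=> ef; rewrite epc in ef.
  do 2!eexists; split; first exact: G_Reconcile (esym ef).
    split=> //=.
    + by rewrite pc_rcons /ann_npc /= epc.
    + by rewrite reg_rcons.
    + by rewrite regts_rcons.
  by rewrite /ann_event /= epc.
- move=> es ef; rewrite epc in ef.
  have es' : gsb q = [::] by move: es; rewrite esb; case: (gsb q).
  do 2!eexists; split; first exact: G_Commit (esym ef) es'.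
    split=> //=.
    + by rewrite pc_rcons /ann_npc /= epc.
    + by rewrite reg_rcons.
    + by rewrite regts_rcons.
  by rewrite /ann_event /= epc.
Qed.

Lemma rem_first_cat (T : Type) (p : pred T) s1 x s2 :
  ~~ has p s1 -> p x -> rem_first p (s1 ++ x :: s2) = s1 ++ s2.
Proof.
move=> no px; elim: s1 no => [|y s1 IH] /=; first by rewrite px.
by rewrite negb_or => /andP[/negbTE -> /IH ->].
Qed.

Lemma lift_deq gs s i a v sts s1 s2 :
  rel gs s -> w_sb (w_procs s i) = s1 ++ WSb a v sts :: s2 ->
  ~~ has (fun x => wsb_a x == a) s1 ->
  exists2 gs', gstep gs gs' /\ (forall j, hist (gp gs' j) = hist (gp gs j)) &
  rel gs'
    (WmmdState (w_gts s).+1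
       [eta w_mem s with a |-> Cell v (Some i) sts (w_gts s).+1]
       (fun j =>
          if j == i then dequeued a (w_procs s i)
          else if sb_has (w_procs s j) a then w_procs s j
          else ib_insert (stale_entry j a (w_mem s a) (w_gts s))
                 (w_procs s j))).
Proof.
move=> [eg em rp] es no; have [epc ereg erts ert esb eib] := rp i.
rewrite esb in es; have [l1 [[a' v' sts' t] [l2 [el el1 [? ? ?] el2]]]] := map_split es.
subst a' v' sts'; have no' : ~~ has (fun y => x_a y == a) l1.
  by rewrite -el1 has_map in no.
eexists; first split; first exact: (G_Deq el no').
  by move=> j /=; rewrite gdeq_hist.
split=> /=; first by rewrite eg.
  by move=> b; rewrite eg; case: eqP.
move=> j; rewrite /gdeq; case: eqP => [->|_].
  split=> //=; rewrite esb es rem_first_cat //; first by rewrite map_cat el1 el2.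
have [epc' ereg' erts' ert' esb' eib'] := rp j.
case ey: (yst (gsb (gp gs j)) a) => [y|].
  case sbj: (sb_has (w_procs s j) a) => //.
  by rewrite (rel_sb_has (rp j)) ?sbj in ey.
have -> : sb_has (w_procs s j) a = false.
  rewrite /sb_has esb' has_map -has_rev; move: ey; rewrite /yst.
  by elim: (rev _) => //= x l IH; case: ifP.
split=> //= x [<-|/eib'[t' gx]]; last by exists t'; left.
by exists (c_t (gmem gs a)); right; rewrite /= em eg.
Qed.

Lemma lift_run tr s :
  run (@wmmd_step Reg Addr PC Val n P) (wmmd_init I) tr s ->
  exists gs, [/\ greach ginit gs, rel gs s
    & forall i, [seq l.2 | l <- tr & l.1 == i] = map ann_event (hist (gp gs i))].
Proof.
elim=> [|tr' s1 l s2 _ [gs [rch rl etr]] st].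
  by exists ginit; split=> //; [apply: greach_refl].
have inv_gs := reach_inv init_inv rch.
case: st => [i ins res w ei ex|i a v sts s1' s2' es no]; last first.
  have [gs' [st eh] rl'] := lift_deq rl es no.
  exists gs'; split=> //; first exact: greach_step rch st.
  by move=> j; rewrite cats0 eh.
have [eg em rp] := rl.
rewrite eg in ex; have [A [q' [gx rq eA]]] := lift_exec (rp i) (inv_gs i) em ei ex.
exists (GState (gts gs) (gmem gs) [eta gp gs with i |-> q']); split=> /=.
- exact: greach_step rch (G_Exec gx).
- by split=> // j /=; case: eqP => [->|_].
- move=> j; rewrite filter_cat map_cat etr /= [i == j]eq_sym.
  case: eqP => [->|_] /=; last by rewrite cats0.
  by have [-> _] := exec_hist gx; rewrite map_rcons cats1 -eA.
Qed.

(** * Reorder buffers that follow the timestamps *)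

Notation pstate := (pstate Reg Addr PC Val n).
Notation entry := (entry Reg Addr PC Val n).
Notation ooo_state := (ooo_state Reg Addr PC Val n).

Definition shape (A : ann) : bool :=
  match a_ins A, a_res A with
  | Nm _ _ _, ResNm _ _ | Ld _ _ _, ResLd _ _ | St _ _ _, ResSt _ _
  | Commit, ResFence | Reconcile, ResFence => true
  | _, _ => false
  end.

Lemma ok_shape i h A : ann_ok i h A -> shape A.
Proof.
case=> _ _ _; rewrite /shape; case: (a_ins A).
- by move=> op srcs dst [npc [v [-> _ _]]].
- by move=> addr srcs dst [a [v [_ -> _ _]]].
- by move=> addr data srcs [-> _ _].
- by move=> ->.
- by move=> ->.
Qed.

(** The last case serves [Commit] and the mismatches that [shape] excludes. *)
Definition filled (A : ann) : robins Reg Addr PC Val n :=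
  match a_ins A, a_res A with
  | Nm op srcs dst, ResNm _ v => RNm op srcs dst (Some v)
  | Ld addr srcs dst, ResLd a v =>
      RLd addr srcs dst (Some a) (Some v) (Some (a_tag A))
  | St addr data srcs, ResSt a v => RSt addr data srcs (Some a) (Some v) (a_tag A)
  | Reconcile, _ => RReconcile
  | _, _ => RCommit
  end.

(** [b] tells whether the instruction has executed. Fences are fetched already done, so both values
    of [b] give them the same entry. *)
Definition ent (i : proc) (b : bool) (k : nat) (A : ann) : entry :=
  Entry k (a_pc A) (ann_npc i A)
    (if b then filled A else fetched_ins i k (a_ins A))
    (if b then Done else fetched_ex (a_ins A)).

(* The reorder buffer holding the instructions l, numbered from k, of which
   those with timestamps below T have executed. *)
Fixpoint robf (i : proc) (T k : nat) (l : seq ann) : seq entry :=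
  if l is A :: l' then ent i (a_ts A < T) k A :: robf i T k.+1 l' else [::].

Lemma robf_cat i T k l1 l2 :
  robf i T k (l1 ++ l2) = robf i T k l1 ++ robf i T (k + size l1) l2.
Proof.
elim: l1 k => [|A l1 IH] k /=; first by rewrite addn0.
by rewrite IH addSnnS.
Qed.

Lemma robf_rcons i T k l A :
  robf i T k (rcons l A) = rcons (robf i T k l) (ent i (a_ts A < T) (k + size l) A).
Proof. by rewrite -!cats1 robf_cat. Qed.

Lemma robf_idx_ge i T k l : all (fun e => k <= e_idx e) (robf i T k l).
Proof.
elim: l k => //= A l IH k; rewrite leqnn /=.
by apply: sub_all (IH k.+1) => e /ltnW.
Qed.

Lemma robf_idx_lt i T k l : all (fun e => e_idx e < k + size l) (robf i T k l).
Proof.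
by elim: l k => //= A l IH k; rewrite -addSnnS IH andbT addSn ltnS leq_addr.
Qed.

(** * Ready sources and searches around one entry *)

Record splits (p : pstate) (k : nat) (es1 : seq entry) (e : entry)
    (es2 : seq entry) : Prop := Splits {
  sp_rob : rob p = es1 ++ e :: es2;
  sp_lt : all (fun e => e_idx e < k) es1;
  sp_eq : e_idx e = k;
  sp_gt : all (fun e => k < e_idx e) es2
}.

Lemma all_filter_none (T : Type) (p q : pred T) s :
  all p s -> (forall x, p x -> ~~ q x) -> filter q s = [::].
Proof.
by move=> + npq; elim: s => //= x s IH /andP[/npq/negbTE -> /IH].
Qed.

Lemma splits_at p k es1 e es2 : splits p k es1 e es2 -> rob_at p k = Some e.
Proof.
case=> er lt ek gt; rewrite /rob_at er filter_cat /= ek eqxx.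
by rewrite (all_filter_none lt) // => x; lia.
Qed.

Lemma splits_older p k es1 e es2 : splits p k es1 e es2 -> older p k = es1.
Proof.
case=> er lt ek gt; rewrite /older er filter_cat /= ek ltnn.
rewrite (all_filter_none gt) ?cats0; first by rewrite (all_filterP lt).
by move=> x; lia.
Qed.

Lemma splits_younger p k es1 e es2 : splits p k es1 e es2 -> younger p k = es2.
Proof.
case=> er lt ek gt; rewrite /younger er filter_cat /= ek ltnn.
rewrite (all_filter_none lt) /=; first by rewrite (all_filterP gt).
by move=> x; lia.
Qed.

Lemma splits_upd p k es1 e es2 f : splits p k es1 e es2 ->
  upd_rob p k f = set_rob p (es1 ++ f e :: es2).
Proof.
case=> er lt ek gt; rewrite /upd_rob er map_cat /= ek eqxx.
have idE es : all (fun e => e_idx e != k) es ->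
    [seq if e_idx e == k then f e else e | e <- es] = es.
  by elim: es => //= x es IH /andP[/negbTE -> /IH ->].
by rewrite !idE //; [apply: sub_all gt | apply: sub_all lt] => x; lia.
Qed.

Definition src_of (es : seq entry) (f : Reg -> Val) (r : Reg) : option Val :=
  if [seq e <- es | writes e r] is e :: es' then dst_val (last e es')
  else Some (f r).

Lemma src_of_rcons es e f r :
  src_of (rcons es e) f r = if writes e r then dst_val e else src_of es f r.
Proof.
rewrite /src_of filter_rcons; case: (writes e r) => //.
by case: [seq _ <- es | _] => //= e' es'; rewrite last_rcons.
Qed.

Lemma ent_writes i b k A r :
  shape A -> writes (ent i b k A) r =
             if ann_write A is Some (dst, _) then dst == r else false.
Proof.
by rewrite /shape /writes /ann_write /ent /filled /=;
  case: (a_ins A) => [???|???|???||] //; case: (a_res A); case: b.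
Qed.

Lemma ent_dst i k A dst v :
  ann_write A = Some (dst, v) -> dst_val (ent i true k A) = Some v.
Proof.
rewrite /dst_val /ann_write /ent /filled /=.
by case: (a_ins A) => [???|???|???||] //; case: (a_res A) => // ?? [_ ->].
Qed.

(** The last writer of [r] in [l] carries the timestamp of the register, so it is at most [T] and
    the writer has executed. Without a writer in [l], the register file left by the committed
    history [h] answers. *)
Lemma src_robf i T k h l r :
  all shape l -> regts_of (h ++ l) r <= T ->
  src_of (robf i T.+1 k l) (reg_of i h) r = Some (reg_of i (h ++ l) r).
Proof.
elim/last_ind: l => [|l A IH]; first by rewrite cats0.
rewrite all_rcons => /andP[shA shl].
rewrite robf_rcons src_of_rcons ent_writes // -rcons_cat regts_rcons reg_rcons.
case ew: (ann_write A) => [[dst v]|] /=; last exact: IH.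
rewrite eq_sym; case: eqP => [_ leT|_]; last exact: IH.
by rewrite ltnS leT; apply: ent_dst ew.
Qed.

Lemma ats_of_ge h srcs r : r \in srcs -> regts_of h r <= ats_of h srcs.
Proof. by move=> inr; apply: leq_bigmax_seq. Qed.

Lemma ready_robf i T k h l srcs p e es2 :
  splits p (k + size l) (robf i T.+1 k l) e es2 -> rf p = reg_of i h ->
  all shape l -> ats_of (h ++ l) srcs <= T ->
  ready p (k + size l) srcs (vals i (h ++ l) srcs).
Proof.
move=> sp erf shl le_T; rewrite /ready /vals -map_comp.
apply/eq_in_map => r inr; rewrite /src_val (splits_older sp) erf /=.
apply: src_robf => //; apply: leq_trans le_T; exact: ats_of_ge.
Qed.

(** The issue bit is false because a store is issued only immediately before the memory performs
    it. *)
Definition tosb (x : gsbe) : sbentry Addr Val n :=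
  SbEntry (x_a x) (x_v x) (x_t x) false.

Lemma bypass_sbE s a :
  bypass_sb (map tosb s) a =
    if yst s a is Some x then Defs.Found (x_v x) (x_t x) else Defs.NotFound Addr Val n.
Proof.
rewrite /bypass_sb /yst -map_rev filter_map /preim /=.
by case: [seq _ <- rev s | _].
Qed.

Lemma rec_rcons h A :
  rec_of (rcons h A) =
    if a_ins A is Reconcile then maxn (rec_of h) (a_g A) else rec_of h.
Proof. by rewrite /rec_of foldl_rcons. Qed.

Lemma lastst_rcons h A a :
  lastst (rcons h A) a = if ann_st A a then a_ts A else lastst h a.
Proof. by rewrite /lastst foldl_rcons. Qed.

Lemma ldsince_rcons h A a :
  ldsince (rcons h A) a =
    if ann_st A a then [::]
    else if ann_ld A a then (a_ts A, a_tag A) :: ldsince h a else ldsince h a.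
Proof. by rewrite /ldsince foldl_rcons. Qed.

(** The youngest store to [a] in [l] has a timestamp of at most [T], so it has executed and is
    found. The search is never blocked: a Reconcile in [l] would have a clock above [T], against the
    bound on [rec_of]. *)
Lemma bypass_robf i T k h l a b res :
  all shape l -> all (fun B => T < a_g B) l ->
  lastst (h ++ l) a <= T -> rec_of (h ++ l) <= T ->
  bypass_rob (rev (robf i T.+1 k l)) a res =
    if has (ann_st^~ a) l then Defs.Found (look b l a).1 (look b l a).2 else res.
Proof.
elim/last_ind: l => // l A IH; rewrite !all_rcons => /andP[shA shl] /andP[gA gl].
rewrite -rcons_cat lastst_rcons rec_rcons robf_rcons rev_rcons has_rcons.
move: shA; rewrite look_rcons /shape /ann_st /ent /= /filled.
case: (a_ins A) => [op srcs dst|addr srcs dst|addr data srcs||].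
- by case: (a_res A) => // npc v _; case: ifP => _ /=; apply: IH.
- by case: (a_res A) => // a' v _; case: ifP => _ /=; apply: IH.
- case: (a_res A) => // a' v _; case: (eqVneq a' a) => [->|na] /=.
    by rewrite ltnS => -> _ /=; rewrite eqxx.
  by case: ifP => _ /=; rewrite ?(negbTE na); apply: IH.
- by case: (a_res A) => // _; case: ifP => _ /=; apply: IH.
- by case: (a_res A) => // _ _; rewrite geq_max => /andP[_ le_g]; lia.
Qed.

Lemma look_nohas b l a : ~~ has (ann_st^~ a) l -> look b l a = b.
Proof.
elim/last_ind: l => // l A IH; rewrite has_rcons negb_or => /andP[/negbTE nst /IH e].
by rewrite look_nst.
Qed.

Lemma ent_st i b k A a :
  shape A -> st_to (ent i b k A) a = b && ann_st A a.
Proof.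
by rewrite /shape /st_to /ann_st /ent /filled /=;
  case: (a_ins A) => [???|???|???||] //; case: (a_res A);
  case: b.
Qed.

Lemma ent_ld i b k A a :
  shape A -> ld_to (ent i b k A) a = b && ann_ld A a.
Proof.
by rewrite /shape /ld_to /ann_ld /ent /filled /=;
  case: (a_ins A) => [???|???|???||] //; case: (a_res A);
  case: b.
Qed.

Lemma ent_stale i b k A a t :
  shape A -> stale_ld (ent i b k A) a t = [&& b, ann_ld A a & a_tag A != t].
Proof.
by rewrite /shape /stale_ld /ann_ld /ent /filled /=;
  case: (a_ins A) => [???|???|???||] //; case: (a_res A);
  case: b.
Qed.

Lemma ok_ld i h A a :
  ann_ok i h A -> ann_ld A a ->
  lastst h a <= a_ts A /\
  forall T t, (T, t) \in ldsince h a -> a_ts A < T -> a_tag A = t.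
Proof.
move=> okA; have := ok_shape okA; case: okA => _ _ _; rewrite /shape /ann_ld.
case: (a_ins A) => [op srcs dst _|addr srcs dst|addr data srcs _|_|_];
  case: (a_res A) => // a' v [a'' [v' [_ [<- _] _ [le_st _ ldP]]]] _ /eqP <-.
by split.
Qed.

Lemma hist_ok_head i h A l : hist_ok i (h ++ A :: l) -> ann_ok i h A.
Proof. by apply. Qed.

(** An executed load from [a] would have a timestamp below [T] but at least that of the last store
    to [a]. A store to [a] that has not executed does not stop the search, but its timestamp is at
    least [T], so the hypothesis survives it. *)
Lemma affected_robf i T k h l a :
  hist_ok i (h ++ l) -> T <= lastst h a -> affected (robf i T k l) a = [::].
Proof.
elim: l h k => //= A l IH h k ok le_T; have okA := hist_ok_head ok.
have shA := ok_shape okA; rewrite ent_st // ent_ld //.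
rewrite -cat_rcons in ok; have := IH _ k.+1 ok; rewrite lastst_rcons.
case: (ltnP (a_ts A) T) => [lt_T|ge_T] /=.
  case: ifP => //= nst; case ld: (ann_ld A a) => /=; last exact.
  by have [le_st _] := ok_ld okA ld; lia.
by case: ifP => // _; apply.
Qed.

(** While no store to [a] intervenes, an executed load has a timestamp below that of a load with tag
    [t] and so read the same store. Past an unexecuted store to [a], the first alternative takes
    over and excludes executed loads. *)
Lemma stale_robf i T k h l a t :
  hist_ok i (h ++ l) -> (T <= lastst h a) || ((T, t) \in ldsince h a) ->
  first_stale (robf i T k l) a t = None.
Proof.
elim: l h k => //= A l IH h k ok le_T; have okA := hist_ok_head ok.
have shA := ok_shape okA; rewrite ent_st // ent_stale //.
rewrite -cat_rcons in ok; have := IH _ k.+1 ok; rewrite lastst_rcons ldsince_rcons.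
case: (ltnP (a_ts A) T) => [lt_T|ge_T] /=.
  case: ifP => //= nst; case ld: (ann_ld A a) => /=; last exact.
  have [le_st ldP] := ok_ld okA ld; case/orP: le_T => [le_T|inT]; first lia.
  by rewrite (ldP _ _ inT lt_T) eqxx /= => -> //; rewrite inE inT !orbT.
case: ifP => [_|nst]; first by rewrite ge_T; apply.
by case: ifP => _; apply => //; rewrite inE orbCA le_T orbT.
Qed.

(** * The out-of-order execution *)

Notation ooo_step := (@ooo_ccm_step Reg Addr PC Val n P).

Inductive silent (s : ooo_state) : ooo_state -> Prop :=
| silent_refl : silent s s
| silent_step s' s'' : silent s s' -> ooo_step s' None s'' -> silent s s''.

Lemma silent_trans s1 s2 s3 : silent s1 s2 -> silent s2 s3 -> silent s1 s3.
Proof. by move=> h12; elim=> // s s' _ IH st; apply: silent_step IH st. Qed.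

Lemma run_silent s0 tr s s' :
  run ooo_step s0 tr s -> silent s s' -> run ooo_step s0 tr s'.
Proof.
move=> r; elim=> // s1 s2 _ IH st.
by have := run_fire IH st; rewrite cats0.
Qed.

Definition quiet (pf : proc -> pstate) (m : Addr -> Val * tag) : ooo_state :=
  OooState pf m (fun=> [::]).

(** Quantifying over [pf] leaves the other processors arbitrary, so that the silent moves of
    different processors compose. *)
Definition psilent (i : proc) (m : Addr -> Val * tag) (p p' : pstate) : Prop :=
  forall pf, pf i = p -> silent (quiet pf m) (quiet [eta pf with i |-> p'] m).

Lemma fupd_fupd (T : eqType) (U : Type) (f : T -> U) i x y :
  [eta [eta f with i |-> x] with i |-> y] = [eta f with i |-> y] :> (T -> U).
Proof. by apply: functional_extensionality => j /=; case: eqP. Qed.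

Lemma fupd_id (T : eqType) (U : Type) (f : T -> U) i x :
  f i = x -> [eta f with i |-> x] = f :> (T -> U).
Proof. by move=> <-; apply: functional_extensionality => j /=; case: eqP => // ->. Qed.

Lemma psilent_refl i m p : psilent i m p p.
Proof. by move=> pf e; rewrite (fupd_id e); apply: silent_refl. Qed.

Lemma psilent_trans i m p1 p2 p3 :
  psilent i m p1 p2 -> psilent i m p2 p3 -> psilent i m p1 p3.
Proof.
move=> h12 h23 pf e; apply: silent_trans (h12 pf e) _.
by rewrite -(fupd_fupd pf i p2 p3); apply: h23; rewrite /= eqxx.
Qed.

Lemma psilent_internal i m p p' :
  ooo_proc_step (P i) i p Internal p' -> psilent i m p p'.
Proof.
move=> st pf e; apply: silent_step (silent_refl _) _.
by apply: Proc_Internal; rewrite /= e.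
Qed.

Lemma psilent_load i m p p' k a v t :
  ooo_proc_step (P i) i p (Request (ReqLd k a)) p' -> m a = (v, t) ->
  psilent i m p (respLd k v t p').
Proof.
move=> st em pf e.
have st1 := @Proc_Request _ _ _ _ _ P (quiet pf m) i (ReqLd k a) p'.
rewrite /= e in st1; have {}st1 := st1 st.
apply: silent_step (silent_step (silent_refl _) st1) _.
set s1 := OooState _ _ _.
have em1 : ccm_mrb s1 i = [::] ++ ReqLd k a :: [::] by rewrite /= eqxx.
have := CCM_Ld P em1 em; rewrite /= eqxx fupd_fupd.
rewrite (fupd_fupd (fun=> [::]) i [:: ReqLd k a] [::]).
by rewrite (fupd_id (f := fun=> [::])).
Qed.

Definition mkp (pc : PC) (f : Reg -> Val) (es : seq entry) (s : seq gsbe)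
    (N : nat) : pstate :=
  PState pc f es (map tosb s) (fun=> false) N.

Definition fence (A : ann) : bool :=
  match a_ins A with Commit | Reconcile => true | _ => false end.

(** At time [T] the older entries have executed up to and including timestamp [T], the younger ones
    only below it. Then the sources of [A] are ready, and its execution disturbs no younger
    entry. *)
Lemma psilent_exec i m T pc N h l1 A l2 s :
  let p b := mkp pc (reg_of i h)
    (robf i T.+1 (size h) l1 ++ ent i b (size h + size l1) A
       :: robf i T (size h + size l1).+1 l2) s N in
  hist_ok i (h ++ l1 ++ A :: l2) -> a_ts A = T -> ~~ fence A ->
  all (fun B => T < a_g B) l1 ->
  (forall a v, a_res A = ResLd a v ->
     (v, a_tag A) = look (if yst s a is Some x then (x_v x, x_t x) else m a) l1 a) ->
  psilent i m (p false) (p true).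
Proof.
move=> p ok ets nf gl ldP.
have ok' : hist_ok i ((h ++ l1) ++ A :: l2) by rewrite -catA.
have okA := hist_ok_head ok'.
have shl : all shape l1.
  apply/(all_nthP A) => j ltj; apply: ok_shape (_ : ann_ok i (h ++ take j l1) _).
  apply: (ok _ _ (drop j.+1 l1 ++ A :: l2)).
  by rewrite -{1}(cat_take_drop j l1) (drop_nth A) // -!catA.
set k := size h + size l1 in p *.
have ek : size (h ++ l1) = k by rewrite size_cat.
pose es1 := robf i T.+1 (size h) l1; pose es2 := robf i T k.+1 l2.
have sp e : e_idx e = k -> splits (mkp pc (reg_of i h) (es1 ++ e :: es2) s N) k es1 e es2.
  by split=> //; [apply: robf_idx_lt | apply: robf_idx_ge].
have spF : splits (p false) k es1 (ent i false k A) es2 by apply: sp.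
have rdy e srcs : e_idx e = k -> ats_of (h ++ l1) srcs <= a_ts A ->
    ready (mkp pc (reg_of i h) (es1 ++ e :: es2) s N) k srcs (vals i (h ++ l1) srcs).
  by rewrite ets => ee le_T; apply: ready_robf (sp e ee) _ _ le_T.
case: okA => epc eins _ resP.
case ei: (a_ins A) resP nf => [op srcs dst|addr srcs dst|addr data srcs||] //;
  rewrite /fence ei // => + _.
- move=> [npc [v [er eop le_ts]]].
  have st := @OOO_NmEx _ _ _ _ _ (P i) i (p false) k (ent i false k A) op srcs dst
    None _ npc v _ (splits_at spF) _ _ (rdy (ent i false k A) _ erefl le_ts) eop erefl.
  move: st; rewrite /ent /= ei /= => st; have {}st := st erefl erefl.
  apply: psilent_internal; move: st.
  (* The prediction made at fetch was the computed next PC, hence no flush. *)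
  rewrite /ann_npc er eqxx (splits_upd _ spF).
  by rewrite /p /ent /filled /ann_npc ei er.
- move=> [a [v [ea er le_ts [le_st le_rec _]]]].
  have ld := ldP a v er.
  have e1 : ent i false k A = Entry k (a_pc A) (ann_npc i A)
      (RLd addr srcs dst None None None) Idle by rewrite /ent ei.
  pose e2 : entry := Entry k (a_pc A) (ann_npc i A)
      (RLd addr srcs dst (Some a) None None) Idle.
  have e4 : ent i true k A = Entry k (a_pc A) (ann_npc i A)
      (RLd addr srcs dst (Some a) (Some v) (Some (a_tag A))) Done.
    by rewrite /ent /filled ei er.
  pose q e := mkp pc (reg_of i h) (es1 ++ e :: es2) s N.
  change (psilent i m (q (ent i false k A)) (q (ent i true k A))); rewrite e4.
  have stA : psilent i m (q (ent i false k A)) (q e2).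
    apply: psilent_internal.
    have := @OOO_LdAddr _ _ _ _ _ (P i) i (q (ent i false k A)) k
      (ent i false k A) addr srcs dst None None _ (splits_at spF) _ _
      (rdy (ent i false k A) _ erefl le_ts).
    rewrite (splits_upd _ spF) e1 /= -ea => st; exact: st.
  apply: psilent_trans stA _.
  have sp2 : splits (q e2) k es1 e2 es2 by apply: sp.
  have byp : findBypass (q e2) k a =
      if has (ann_st^~ a) l1 || yst s a then Defs.Found v (a_tag A)
      else Defs.NotFound Addr Val n.
    rewrite /findBypass (splits_older sp2) /= bypass_sbE.
    rewrite (@bypass_robf i T _ h l1 a
      (if yst s a is Some x then (x_v x, x_t x) else m a) _ shl gl) -?ets //.
    rewrite -ld /=; case hs: (has _ l1) => //=.
    by move: ld; rewrite look_nohas ?hs //; case: yst => // x [<- <-].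
  case hb: (_ || _) in byp.
    apply: psilent_internal.
    have := @OOO_LdBypass _ _ _ _ _ (P i) i (q e2) k e2 addr srcs dst a None None
      _ v (a_tag A) (splits_at sp2) erefl erefl (rdy e2 _ erefl le_ts) byp.
    by rewrite (splits_upd _ sp2).
  have ema : m a = (v, a_tag A).
    move/negbT: hb; rewrite negb_or => /andP[nh]; rewrite ld look_nohas //.
    by case: yst.
  have st := @OOO_LdReq _ _ _ _ _ (P i) i (q e2) k e2 addr srcs dst a None None
      _ (splits_at sp2) erefl erefl (rdy e2 _ erefl le_ts) byp isT.
  have := psilent_load st ema; rewrite (splits_upd _ sp2).
  pose e3 : entry := with_ex Exe e2.
  have sp3 : splits (q e3) k es1 e3 es2 by apply: sp.
  rewrite -/(q e3) /respLd /= (splits_at sp3) /=.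
  rewrite (splits_upd _ sp3) /findStaleLd.
  set e4' := with_ins _ _ _; have sp4 : splits (q e4') k es1 e4' es2 by apply: sp.
  rewrite -/(q e4') (splits_younger sp4).
  (* [A] itself is the load of timestamp [T] that the second alternative of [stale_robf] asks
     for. *)
  rewrite (@stale_robf i T k.+1 (rcons (h ++ l1) A) l2) ?cat_rcons // lastst_rcons ldsince_rcons.
  by rewrite /ann_st /ann_ld er eqxx inE ets eqxx orbT.
- move=> [er le_ts etag].
  have := @OOO_StEx _ _ _ _ _ (P i) i (p false) k (ent i false k A) addr data srcs
    None None (inr (i, k)) _ _ _ _ (splits_at spF) _ _ (rdy (ent i false k A) _ erefl le_ts)
    erefl erefl erefl.
  rewrite {1 2}/ent /= ei /= => st; have {}st := st erefl erefl.
  apply: psilent_internal; move: st.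
  rewrite /findAffectedLd (splits_younger spF).
  (* For the younger entries the last store to the address is [A], of timestamp exactly [T]. *)
  rewrite (@affected_robf i T k.+1 (rcons (h ++ l1) A) l2) ?cat_rcons //; last first.
    by rewrite lastst_rcons /ann_st er eqxx ets.
  rewrite /= (splits_upd _ spF) /p /ent /filled ei er /= etag ek.
  by [].
Qed.

Lemma psilent_segment i m T pc N h l s :
  hist_ok i (h ++ l) -> all (fun A => T < a_g A) l ->
  (forall l1 A l2 a v, l = l1 ++ A :: l2 -> a_res A = ResLd a v -> a_ts A = T ->
     (v, a_tag A) = look (if yst s a is Some x then (x_v x, x_t x) else m a) l1 a) ->
  psilent i m (mkp pc (reg_of i h) (robf i T (size h) l) s N)
              (mkp pc (reg_of i h) (robf i T.+1 (size h) l) s N).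
Proof.
move=> ok gl ldP.
(* The sweep runs in program order: [l1] has reached the threshold [T.+1], [l2] has not. Raising the
   threshold changes only entries of timestamp exactly [T]. *)
suff gen l2 : forall l1, l = l1 ++ l2 ->
    psilent i m
      (mkp pc (reg_of i h)
         (robf i T.+1 (size h) l1 ++ robf i T (size h + size l1) l2) s N)
      (mkp pc (reg_of i h) (robf i T.+1 (size h) l) s N).
  by have := gen l [::] erefl; rewrite /= addn0.
elim: l2 => [|A l2 IH] l1 el.
  by rewrite /= cats0 el cats0; apply: psilent_refl.
have := IH (rcons l1 A); rewrite cat_rcons el size_rcons addnS robf_rcons cat_rcons.
move=> /(_ erefl) /=; set k := size h + size l1.
case: (ltngtP (a_ts A) T) => [lt|gt|ets].
- by rewrite ltnW.
- by rewrite ltnS leqNgt gt.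
- rewrite ets ltnS leqnn; case fA: (fence A).
    have -> // : ent i true k A = ent i false k A.
    by move: fA; rewrite /fence /ent /filled; case: (a_ins A).
  apply: psilent_trans; apply: psilent_exec => //.
  + by rewrite -el.
  + by rewrite fA.
  + by move: gl; rewrite el all_cat => /andP[].
  + by move=> a v er; apply: ldP el er ets.
Qed.

Lemma silent_all pf pf' m :
  (forall i, psilent i m (pf i) (pf' i)) -> silent (quiet pf m) (quiet pf' m).
Proof.
move=> ps.
suff gen (r : seq proc) : uniq r -> silent (quiet pf m)
    (quiet (fun j => if j \in r then pf' j else pf j) m).
  have -> : pf' = fun j => if j \in enum 'I_n then pf' j else pf j.
    by apply: functional_extensionality => j; rewrite mem_enum.
  by apply: gen; apply: enum_uniq.
elim: r => [_|i r IH /= /andP[nir /IH]]; first exact: silent_refl.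
move/silent_trans; apply.
set pf1 := fun j => _.
have -> : (fun j => if j \in i :: r then pf' j else pf j) = [eta pf1 with i |-> pf' i].
  apply: functional_extensionality => j; rewrite /pf1 /= inE.
  by case: eqP => [->|].
by apply: ps; rewrite /pf1 (negbTE nir).
Qed.

(** Predictions for [Nm] are unrestricted, so they can be read off the history. At threshold 0 no
    entry has executed. *)
Lemma psilent_fetch i m l f :
  hist_ok i l ->
  psilent i m (mkp (init_pc I i) f [::] [::] 0)
              (mkp (pc_of i l) f (robf i 0 0 l) [::] (size l)).
Proof.
elim/last_ind: l => [|l A IH] ok; first exact: psilent_refl.
have okA : ann_ok i l A by apply: ok; rewrite -cats1.
have okl : hist_ok i l.
  by move=> h1 B h2 el; apply: (ok h1 B (rcons h2 A)); rewrite el rcons_cat.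
apply: psilent_trans (IH okl) _; apply: psilent_internal.
have := @OOO_Fetch _ _ _ _ _ (P i) i
  (mkp (pc_of i l) f (robf i 0 0 l) [::] (size l)) (a_ins A) (ann_npc i A).
have [epc ei _ resP] := okA; rewrite /= -epc => /(_ ei).
rewrite robf_rcons size_rcons pc_rcons /ent /= add0n; apply.
move: resP; rewrite /ann_npc; case: (a_ins A) => //.
- by move=> ? ? ? [? [? [_ -> _ _]]].
- by move=> ? ? ? [-> _ _].
- by move=> ->.
- by move=> ->.
Qed.

Lemma commit_step i pc h k A es s N :
  shape A -> (a_ins A = Commit -> s = [::]) ->
  ooo_proc_step (P i) i (mkp pc (reg_of i h) (ent i true k A :: es) s N)
    (Committed (ann_event A))
    (mkp pc (reg_of i (rcons h A)) es
       (if a_res A is ResSt a v then rcons s (Gsb a v (a_ts A) (a_tag A)) else s) N).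
Proof.
set p := mkp _ _ _ _ _; move=> shA sbP.
have eE r : a_res A = r -> rob_instr (e_ins (ent i true k A)) = a_ins A ->
    commit_event (ent i true k A) r = ann_event A.
  by rewrite /commit_event /ann_event => -> ->.
have eI : rob_instr (e_ins (ent i true k A)) = a_ins A.
  by move: shA; rewrite /shape /ent /filled /=; case: (a_ins A) => [???|???|???||];
    case: (a_res A).
rewrite reg_rcons /ann_write.
case ei: (a_ins A) shA => [op srcs dst|addr srcs dst|addr data srcs||];
  rewrite /shape ei; case er: (a_res A) => [npc v|a v|a v|] // _.
- have := @OOO_NmCom _ _ _ _ _ (P i) i p (ent i true k A) es op srcs dst v erefl.
  rewrite {1}/ent /= /filled ei er => /(_ erefl erefl).
  by rewrite /ann_npc er -(eE _ er eI).
- have := @OOO_LdCom _ _ _ _ _ (P i) i p (ent i true k A) es addr srcs dst a v _ erefl.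
  rewrite {1}/ent /= /filled ei er => /(_ _ erefl erefl).
  by rewrite -(eE _ er eI).
- have := @OOO_StCom _ _ _ _ _ (P i) i p (ent i true k A) es addr data srcs a v _ erefl.
  rewrite {1}/ent /= /filled ei er => /(_ _ erefl erefl).
  by rewrite -(eE _ er eI) /mkp map_rcons.
- have e0 : sb p = [::] by rewrite /= (sbP ei).
  have := @OOO_ComCom _ _ _ _ _ (P i) i p (ent i true k A) es erefl.
  rewrite {1}/ent /= /filled ei => /(_ erefl e0).
  by rewrite -(eE _ er eI).
- have := @OOO_RecCom _ _ _ _ _ (P i) i p (ent i true k A) es erefl.
  rewrite {1}/ent /= /filled ei => /(_ erefl erefl).
  by rewrite -(eE _ er eI).
Qed.

(** * The simulation of tagged WMM-D *)

Lemma exec_sb i g m q A q' :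
  gexec i g m q A q' ->
  gsb q' = (if a_res A is ResSt a v
            then rcons (gsb q) (Gsb a v (a_ts A) (a_tag A)) else gsb q) /\
  (a_ins A = Commit -> gsb q = [::]).
Proof. by case. Qed.

(** Everything up to the future state [sF] has been fetched and everything up to [s] committed. The
    threshold [T] is separate from [gts s] because, just before a dequeue, execution is already one
    tick ahead. *)
Definition sim_proc (T : nat) (s sF : gstate) (i : proc) : pstate :=
  let h := hist (gp s i) in
  let l := hist (gp sF i) in
  mkp (pc_of i l) (reg_of i h) (robf i T (size h) (drop (size h) l))
    (gsb (gp s i)) (size l).

Definition sim_mem (s : gstate) (a : Addr) : Val * tag :=
  (c_v (gmem s a), c_t (gmem s a)).

Definition sim_state (s sF : gstate) : ooo_state :=
  quiet (sim_proc (gts s) s sF) (sim_mem s).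

Lemma silent_deq pf m i x t1 t2 pc f es N :
  pf i = mkp pc f es (t1 ++ x :: t2) N ->
  ~~ has (fun y => x_a y == x_a x) t1 ->
  silent (quiet pf m)
    (quiet [eta pf with i |-> mkp pc f es (t1 ++ t2) N]
       [eta m with x_a x |-> (x_v x, x_t x)]).
Proof.
move=> ep no; set s0 := quiet pf m.
have no' : ~~ has (fun y => sb_a y == x_a x) (map tosb t1) by rewrite has_map.
have esb : sb (ooo_procs s0 i) =
    map tosb t1 ++ SbEntry (x_a x) (x_v x) (x_t x) false :: map tosb t2.
  by rewrite /= ep /= map_cat.
have st1 := Proc_Request (OOO_StReq (P i) i esb no').
apply: silent_step (silent_step (silent_refl _) st1) _.
set s1 := OooState _ _ _.
have em1 : ccm_mrb s1 i = [::] ++ ReqSt (x_a x) (x_v x) (x_t x) :: [::].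
  by rewrite /= eqxx.
have := CCM_St P em1; rewrite /= eqxx fupd_fupd.
rewrite (fupd_fupd (fun=> [::]) i [:: ReqSt _ _ _] [::]).
rewrite (fupd_id (f := fun=> [::])) // ep /respSt /set_sb /=.
by rewrite rem_first_cat // -map_cat.
Qed.

(** Induction on the run that leads to [s], keeping the future [sF] of which all instructions are
    fetched at the start. *)
Lemma simulation s sF :
  greach ginit s -> greach s sF ->
  exists2 tr, run ooo_step (ooo_ccm_init I) tr (sim_state s sF) &
    forall i, [seq l.2 | l <- tr & l.1 == i] = map ann_event (hist (gp s i)).
Proof.
move=> rch; elim: rch sF => {s} [|s1 s2 rch IH st] sF rchF.
  exists [::] => //; apply: run_silent (run_start _ _) _.
  apply: silent_all => i; rewrite /sim_proc /= drop0.
  exact: psilent_fetch (inv_hist (reach_inv init_inv rchF i)).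
have rch1F : greach s1 sF.
  by apply: greach_trans rchF; apply: greach_step (greach_refl _) st.
have [tr rn etr] := IH sF rch1F.
have inv1 := reach_inv init_inv rch.
have okF i := inv_hist (reach_inv inv1 rch1F i).
have ldF i := reach_look i inv1 rch1F.
case: st rchF => [i A q ex|i x t1 t2 esb no] rchF.
  have [eh eg] := exec_hist ex; have [es sbC] := exec_sb ex.
  have [l2 [eF _ _]] := reach_hist i rchF; rewrite /= eqxx eh in eF.
  have ok := okF i; rewrite eF cat_rcons in ok; have okA := hist_ok_head ok.
  exists (tr ++ [:: (i, ann_event A)]); last first.
    move=> j; rewrite filter_cat map_cat etr /= [i == j]eq_sym.
    case: eqP => [->|_] /=; last by rewrite cats0.
    by rewrite eh map_rcons cats1.
  pose h := hist (gp s1 i); pose l := hist (gp sF i).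
  pose p b := mkp (pc_of i l) (reg_of i h)
    (ent i b (size h) A :: robf i (gts s1) (size h).+1 l2) (gsb (gp s1 i)) (size l).
  have ep : sim_proc (gts s1) s1 sF i = p (a_ts A < gts s1).
    by rewrite /sim_proc /p /l eF cat_rcons drop_size_cat.
  have ps : psilent i (sim_mem s1) (sim_proc (gts s1) s1 sF i) (p true).
    (* A timestamp below the clock means that [A] has already executed. Otherwise the timestamp
       equals the clock, which it cannot exceed, and [A] executes now at the commit slot. *)
    rewrite ep; case: (ltnP (a_ts A) (gts s1)) => [_|ge]; first exact: psilent_refl.
    case fA: (fence A).
      have -> : p false = p true; last exact: psilent_refl.
      by congr mkp; congr cons; move: fA; rewrite /fence /ent /filled; case: (a_ins A).
    have ets : a_ts A = gts s1.
      by apply/eqP; rewrite eqn_leq ge andbT -eg; case: okA.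
    have := @psilent_exec i (sim_mem s1) (gts s1) (pc_of i l) (size l) h [::] A l2
      (gsb (gp s1 i)); rewrite /= addn0; apply=> //; first by rewrite fA.
    move=> a v er; have [l0 [el0 _ ldP]] := ldF i.
    have e0 : l0 = A :: l2.
      by move: el0; rewrite eF cat_rcons => /(f_equal (drop (size h)));
        rewrite !drop_size_cat.
    have := ldP [::] A l2 a v e0 er ets.
    by rewrite /base /sim_mem.
  have rn1 := run_silent rn (ps _ erefl).
  set s' := quiet _ _ in rn1.
  have cs := @commit_step i (pc_of i l) h (size h) A
    (robf i (gts s1) (size h).+1 l2) (gsb (gp s1 i)) (size l) (ok_shape okA) sbC.
  have cs' : ooo_proc_step (P i) i (ooo_procs s' i) (Committed (ann_event A))
      (mkp (pc_of i l) (reg_of i (hist q)) (robf i (gts s1) (size h).+1 l2)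
         (gsb q) (size l)).
    by rewrite /= eqxx es eh.
  have := run_fire rn1 (Proc_Commit cs'); congr run.
  rewrite /sim_state /s' /= /quiet fupd_fupd; congr OooState.
  apply: functional_extensionality => j /=; rewrite /sim_proc /=.
  case: eqP => [->|//]; rewrite eh /l eF size_rcons.
  by rewrite drop_size_cat ?size_rcons.
exists tr; last by move=> j; rewrite etr /= gdeq_hist.
(* Before the clock advances, every processor executes its remaining entries of timestamp [gts s1].
   All entries still in its reorder buffer are executed by WMM-D after the dequeue, hence at a
   larger clock. *)
have seg j : psilent j (sim_mem s1) (sim_proc (gts s1) s1 sF j)
                     (sim_proc (gts s1).+1 s1 sF j).
  have [l [eF gl _]] := reach_hist j rchF; rewrite /= gdeq_hist in eF gl.
  rewrite /sim_proc eF drop_size_cat //; apply: psilent_segment => //.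
    by rewrite -eF.
  have [l0 [el0 _ ldP]] := ldF j.
  have e0 : l0 = l.
    move: el0; rewrite eF => /(f_equal (drop (size (hist (gp s1 j))))).
    by rewrite !drop_size_cat.
  by move=> l1 A l2 a v el er ets; apply: (ldP l1 A l2) => //; rewrite e0.
have rn1 := run_silent rn (silent_all seg).
have ep := erefl (sim_proc (gts s1).+1 s1 sF i); rewrite {2}/sim_proc esb in ep.
have := run_silent rn1 (silent_deq (sim_mem s1) ep no).
congr run; rewrite /sim_state /quiet; congr OooState.
  apply: functional_extensionality => j; rewrite /sim_proc /= /gdeq.
  case: eqP => [->|_] //=; by case: yst.
by apply: functional_extensionality => a; rewrite /sim_mem /=; case: eqP.
Qed.

End Simulation.

Theorem theorem4 (Reg Addr PC : eqType) (Val : Type) (n : nat)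
    (P : 'I_n -> program Reg Addr PC Val)
    (I : init_state Reg Addr PC Val n) :
  behaviors_included (wmmd P I) (ooo_ccm P I).
Proof.
move=> b [tr [s [rn sb0 eb em]]].
have [gs [rch rl etr]] := lift_run rn.
(* Taking the final state as its own future leaves no fetched instruction uncommitted. *)
have [tr' rn' etr'] := simulation rch (greach_refl _ _ gs).
exists tr', (sim_state P I gs gs); split=> //.
- move=> i /=; have := sb0 i.
  by rewrite (rel_sb (rel_procs rl i)); case: (gsb _).
- by move=> i; rewrite eb etr etr'.
- by move=> a; rewrite em /= (rel_mem rl).
Qed.
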